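(* There exists a graph on sixteen vertices such that constructing a circle packing for the graph on a radical computation tree is not possible.
   Context: A circle packing representing a planar graph $G$ is a collection of circles in the plane with pairwise disjoint interiors, one per vertex, such that the circles of adjacent vertices are tangent; constructing it means computing all centers (as complex numbers) and radii. An algebraic computation tree is a rooted tree whose computation nodes compute a value as the sum, difference, product or quotient of integer constants and values computed at ancestor nodes, and whose decision nodes test whether a computed value is greater than zero and branch. A radical computation tree additionally allows computing the $k$-th root of a previously computed value ($k$ an integer parameter) and complex conjugation. *)

(* Defs.v *)
(* with C = Stdlib's R[i] (the complex numbers, via mathcomp-real-closed). *)
From Stdlib Require Import Reals.
From mathcomp Require Import all_boot all_order all_algebra.
From mathcomp Require Import Rstruct complex.
Set Implicit Arguments. Unset Strict Implicit. Unset Printing Implicit Defensive.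
Import Order.TTheory GRing.Theory Num.Theory.
Local Open Scope ring_scope.

(* The complex numbers. *)
Definition Cplx : numClosedFieldType := R[i].

(* ---------- Circle packings ---------- *)
(* Circle of vertex v: center c v, radius r v (a positive real, i.e. 0 < r v in C). *)
Definition circle_packing (n : nat) (e : rel 'I_n) (c r : 'I_n -> Cplx) : Prop :=
  (forall v, 0 < r v) /\
  (* pairwise disjoint (open) interiors *)
  (forall u v, u != v -> ~ exists z : Cplx, `|z - c u| < r u /\ `|z - c v| < r v) /\
  (* circles of adjacent vertices are tangent: they meet in exactly one point *)
  (forall u v, e u v ->
     exists! z : Cplx, `|z - c u| = r u /\ `|z - c v| = r v).

(* ---------- Radical computation trees (no input: the graph is fixed) ---------- *)
(* Values computed along a branch are stored in order; index i refers to the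
   i-th value computed at an ancestor node.  A leaf outputs, for every vertex,
   the indices of the computed values giving its center and its radius. *)
Inductive rct (n : nat) : Type :=
| RLeaf  of ('I_n -> nat * nat)
| RConst of int & rct n                  (* integer constant *)
| RAdd   of nat & nat & rct n
| RSub   of nat & nat & rct n
| RMul   of nat & nat & rct n
| RDiv   of nat & nat & rct n
| RRoot  of nat & nat & rct n            (* k-th root of value i *)
| RConj  of nat & rct n                  (* complex conjugation *)
| RTest  of nat & rct n & rct n.         (* branch on value > 0 *)

(* Execution relation.  A k-th root node may return any k-th root (the
   semantics is nondeterministic, which only makes impossibility stronger);
   division by zero aborts the computation. *)
Inductive rct_run (n : nat) : rct n -> seq Cplx -> ('I_n -> Cplx * Cplx) -> Prop :=
| run_leaf f env :
    (forall v, ((f v).1 < size env)%N /\ ((f v).2 < size env)%N) ->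
    rct_run (RLeaf f) env (fun v => (env`_((f v).1), env`_((f v).2)))
| run_const z t env out :
    rct_run t (rcons env (z%:~R)) out -> rct_run (RConst z t) env out
| run_add i j t env out : (i < size env)%N -> (j < size env)%N ->
    rct_run t (rcons env (env`_i + env`_j)) out -> rct_run (RAdd i j t) env out
| run_sub i j t env out : (i < size env)%N -> (j < size env)%N ->
    rct_run t (rcons env (env`_i - env`_j)) out -> rct_run (RSub i j t) env out
| run_mul i j t env out : (i < size env)%N -> (j < size env)%N ->
    rct_run t (rcons env (env`_i * env`_j)) out -> rct_run (RMul i j t) env out
| run_div i j t env out : (i < size env)%N -> (j < size env)%N ->
    env`_j != 0 ->
    rct_run t (rcons env (env`_i / env`_j)) out -> rct_run (RDiv i j t) env out
| run_root k i t env out (w : Cplx) : (0 < k)%N -> (i < size env)%N ->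
    w ^+ k = env`_i ->
    rct_run t (rcons env w) out -> rct_run (RRoot k i t) env out
| run_conj i t env out : (i < size env)%N ->
    rct_run t (rcons env (env`_i)^*) out -> rct_run (RConj i t) env out
| run_test_pos i t1 t2 env out : (i < size env)%N -> 0 < env`_i ->
    rct_run t1 env out -> rct_run (RTest i t1 t2) env out
| run_test_npos i t1 t2 env out : (i < size env)%N -> ~~ (0 < env`_i) ->
    rct_run t2 env out -> rct_run (RTest i t1 t2) env out.

(* The tree t constructs a circle packing representing the graph e. *)
Definition rct_constructs_packing (n : nat) (e : rel 'I_n) (t : rct n) : Prop :=
  exists out : 'I_n -> Cplx * Cplx,
    rct_run t [::] out /\
    circle_packing e (fun v => (out v).1) (fun v => (out v).2).

(* Main.v *)
Require Import Defs.
From Stdlib Require Import Reals.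
From Stdlib Require Import Classical.
From mathcomp Require Import all_boot all_order all_algebra.
From mathcomp Require Import all_fingroup all_solvable all_field.
From mathcomp Require Import Rstruct complex polyrcf.
From mathcomp Require Import zify ring lra.

(* Write [lambda u v] for the square root of (|c_u - c_v|^2 - (r_u - r_v)^2) /
   (4 r_u r_v): it is at least 1 for disjoint discs, with equality for tangent
   ones.  If the neighbours of a vertex form a cycle, then [lambda] satisfies
   Ptolemy's identity along this cycle.  In a seven-wheel whose rim is shared
   between two further adjacent circles, these identities force [lambda] of two
   rim circles at distance two to be a root of the irreducible quintic
   X^5 - 5X^3 + 7X - 2, which has exactly three real roots.  By Kronecker's
   theorem (an irreducible polynomial of odd prime degree that is solvable by
   radicals has one real root or only real roots) this number cannot be
   reached by a radical computation tree.

   For Kronecker's theorem one follows a tower of subfields stable under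
   complex conjugation.  A root of the polynomial of degree q can lose degree
   only when a p-th root u is adjoined that already lies in the field generated
   by that root; comparing traces then gives p = q, and the values at the q
   conjugate roots are exactly the u zeta^i.  Adjoining |w|^2 before w makes u
   either real or of modulus fixed by the ground field, and both cases
   contradict the presence of two real roots and two complex conjugate roots. *)

Set Implicit Arguments. Unset Strict Implicit. Unset Printing Implicit Defensive.
Import Order.TTheory GRing.Theory Num.Theory.
Local Open Scope ring_scope.

(** * Kummer extensions *)

Section Image.
Variables (F L : fieldType) (iota : {rmorphism F -> L}).

Definition in_image (x : L) : Prop := exists a, iota a = x.

Lemma in_image_map a : in_image (iota a). Proof. by exists a. Qed.
Lemma in_image0 : in_image 0. Proof. by exists 0; rewrite rmorph0. Qed.
Lemma in_imageD x y : in_image x -> in_image y -> in_image (x + y).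
Proof. by case=> a <- [b <-]; exists (a + b); rewrite rmorphD. Qed.
Lemma in_imageN x : in_image x -> in_image (- x).
Proof. by case=> a <-; exists (- a); rewrite rmorphN. Qed.
Lemma in_imageB x y : in_image x -> in_image y -> in_image (x - y).
Proof. by move=> hx hy; apply/in_imageD/in_imageN. Qed.
Lemma in_imageM x y : in_image x -> in_image y -> in_image (x * y).
Proof. by case=> a <- [b <-]; exists (a * b); rewrite rmorphM. Qed.
Lemma in_imageV x : in_image x -> in_image x^-1.
Proof. by case=> a <-; exists a^-1; rewrite fmorphV. Qed.
Lemma in_image_div x y : in_image x -> in_image y -> in_image (x / y).
Proof. by move=> hx hy; apply/in_imageM/in_imageV. Qed.
Lemma in_imageX n x : in_image x -> in_image (x ^+ n).
Proof. by case=> a <-; exists (a ^+ n); rewrite rmorphXn. Qed.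
Lemma in_image_nat n : in_image n%:R.
Proof. by exists n%:R; rewrite rmorph_nat. Qed.
Lemma in_image_int n : in_image n%:~R.
Proof. by exists n%:~R; rewrite rmorph_int. Qed.
Lemma in_image_sum (I : Type) (r : seq I) (P : pred I) (E : I -> L) :
  (forall i, in_image (E i)) -> in_image (\sum_(i <- r | P i) E i).
Proof. by move=> h; apply: big_ind => //; [apply: in_image0 | apply: in_imageD]. Qed.
Lemma in_image_horner (g : {poly F}) x :
  in_image x -> in_image (map_poly iota g).[x].
Proof. by case=> a <-; rewrite horner_map; apply: in_image_map. Qed.

(** By Bezout, [u] is a quotient of powers of [u ^+ m] and [u ^+ n]. *)
Lemma in_image_coprime_exp m n (u : L) : coprime m n -> (0 < m)%N ->
  in_image (u ^+ m) -> in_image (u ^+ n) -> in_image u.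
Proof.
move=> co m_gt0 um un; have [->|u0] := eqVneq u 0; first exact: in_image0.
have /coprimeP[//|[k l] /= kl] := co.
have kl' : (k * m)%N = (l * n).+1.
  by lia.
have -> : u = (u ^+ m) ^+ k / (u ^+ n) ^+ l.
  rewrite -!exprM mulnC kl' exprS [(n * l)%N]mulnC mulfK //.
  by rewrite expf_neq0.
by apply: in_image_div; apply: in_imageX.
Qed.

Section Kummer.
Variables (p : nat) (z u : L).
Hypotheses (p_prime : prime p) (prim_z : p.-primitive_root z).

Lemma factor_Xn_sub (a : L) (v : L) : v != 0 -> a = v ^+ p ->
  'X^p - a%:P = \prod_(i <- index_iota 0 p) ('X - (z ^+ i * v)%:P).
Proof.
move=> v0 ->; have p_gt0 := prime_gt0 p_prime.
pose rs := [seq z ^+ i * v | i <- index_iota 0 p].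
rewrite -(big_map (fun i => z ^+ i * v) predT (fun r => 'X - r%:P)) -/rs.
rewrite [LHS](@all_roots_prod_XsubC _ _ rs); first 1 last.
- by rewrite size_XnsubC // size_map size_iota subn0.
- apply/allP=> _ /mapP[i _ ->] /=; rewrite rootE !hornerE.
  by rewrite exprMn exprAC (prim_expr_order prim_z) expr1n mul1r subrr.
- rewrite uniq_rootsE map_inj_in_uniq ?iota_uniq // => i j.
  rewrite !mem_index_iota => ltin ltjn /(mulIf v0) /eqP.
  by rewrite (eq_prim_root_expr prim_z) !modn_small // => /eqP.
by rewrite (monicP (monicXnsubC _ p_gt0)) scale1r.
Qed.

Hypotheses (zF : in_image z) (upF : in_image (u ^+ p)) (uF : ~ in_image u).

(** In other words, ['X^p - u^p] is irreducible over [F]. Its gcd with a nonzero [g] would split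
    over [L] into n factors ['X - (z ^+ i * u)] with 0 < n < p; the constant term puts [u ^+ n] into
    the image of [F], and coprimality of n and [p] then puts [u] there. *)
Lemma kummer_degree (g : {poly F}) :
  (size g <= p)%N -> (map_poly iota g).[u] = 0 -> g = 0.
Proof.
move=> sg gu; have [//|g0] := eqVneq g 0.
have u0 : u != 0 by apply/eqP => u0; apply: uF; rewrite u0; apply: in_image0.
have [a aup] := upF; pose m := 'X^p - a%:P : {poly F}.
have p_gt0 := prime_gt0 p_prime.
have m0 : m != 0 by rewrite -size_poly_gt0 size_XnsubC.
pose d := gcdp g m.
have d0 : d != 0 by rewrite gcdp_eq0 (negPf g0).
have mE : map_poly iota m = 'X^p - (u ^+ p)%:P.
  by rewrite rmorphB /= map_polyXn map_polyC /= aup.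
have ud : root (map_poly iota d) u.
  rewrite gcdp_map root_gcd /root gu eqxx mE.
  by rewrite !hornerE subrr eqxx.
have sd1 : (1 < size d)%N.
  by rewrite -(size_map_poly iota) (root_size_gt1 _ ud) // map_poly_eq0.
have sdp : (size d <= p)%N by apply: leq_trans sg; rewrite dvdp_leq ?dvdp_gcdl.
have : map_poly iota d %| map_poly iota m by rewrite dvdp_map dvdp_gcdr.
rewrite mE (factor_Xn_sub u0 erefl) => /dvdp_prod_XsubC[mk].
set s := mask _ _ => eqd.
have ssize : size s = (size d).-1.
  by rewrite -(size_map_poly iota d) (eqp_size eqd) size_prod_XsubC.
have constE (c : L) : \prod_(i <- s) c = c ^+ size s.
  by rewrite big_const_seq count_predT iter_mulr_1.
case/eqpP: eqd => -[c1 c2] /= /andP[c10 c20] dE.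
have c12 : c1 * iota (lead_coef d) = c2.
  move/(congr1 lead_coef): dE; rewrite !lead_coefZ lead_coef_map => ->.
  by rewrite (monicP (monic_prod_XsubC _ _ _)) mulr1.
have {dE} : in_image (\prod_(i <- s) (z ^+ i * u)).
  exists ((-1) ^+ (size s) * (d.[0] / lead_coef d)).
  move/(congr1 (fun q => q.[0])): dE; rewrite !hornerZ horner_prod.
  under eq_bigr do rewrite hornerXsubC sub0r -mulN1r.
  rewrite big_split /= constE -c12.
  rewrite (_ : (map_poly iota d).[0] = iota d.[0]); last first.
    by rewrite -[0 in LHS](rmorph0 iota) horner_map.
  rewrite -mulrA => /(mulfI c10) h.
  rewrite rmorphM fmorph_div h rmorphXn rmorphN1 [iota _ * _]mulrC mulfK.
    by rewrite mulrA -exprMn mulrNN mulr1 expr1n mul1r.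
  by rewrite fmorph_eq0 lead_coef_eq0.
rewrite big_split /= constE => hprod.
suff ue : in_image (u ^+ size s).
  case: uF; apply: (@in_image_coprime_exp p (size s)) => //.
  rewrite prime_coprime //; apply/negP => /dvdn_leq; rewrite ssize.
  by case: (size d) sd1 sdp => // k; rewrite ltnS /= => -> sdp /(_ isT); rewrite leqNgt sdp.
have zs : in_image (\prod_(i <- s) z ^+ i).
  by apply: big_ind => [|x y|i _]; [apply: in_image_nat 1%N | apply: in_imageM | apply: in_imageX].
have zs0 : \prod_(i <- s) z ^+ i != 0.
  rewrite prodf_seq_neq0; apply/allP => i _ /=.
  by rewrite expf_neq0 // (prim_root_eq0 prim_z) -lt0n.
by move: (in_image_div hprod zs); rewrite mulrAC divff // mul1r.
Qed.

End Kummer.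
End Image.

(** * Kronecker's theorem on equations solvable by radicals *)

(** [m] is any nonzero polynomial vanishing at [u], so the representing [g] is in general not
    unique; reduction modulo [m] bounds its size. *)
Lemma adjoin_root (F L : fieldType) (iota : {rmorphism F -> L}) (m : {poly F})
    (u : L) : m != 0 -> (map_poly iota m).[u] = 0 ->
  exists (F1 : fieldType) (iota1 : {rmorphism F1 -> L}), forall x,
    in_image iota1 x <->
    exists2 g : {poly F}, (size g < size m)%N & x = (map_poly iota g).[u].
Proof.
move=> m0 /eqP mu; exists (subFExtend iota u m).
exists (@subfx_inj _ _ iota u m : {rmorphism _ -> _}) => x; split.
  case=> a <-; have [g ->] := subfxE a; exists (g %% m); first by rewrite ltn_modp.
  rewrite /= subfx_inj_eval // {1}(divp_eq g m) rmorphD rmorphM /= !hornerE.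
  by rewrite (eqP mu) mulr0 add0r.
case=> g _ ->; exists (subfx_eval iota u m g).
by rewrite /= subfx_inj_eval.
Qed.

Section Horner.
Variables (F L F1 : fieldType) (iota : {rmorphism F -> L}) (iota1 : {rmorphism F1 -> L}).
Hypothesis sub : forall x, in_image iota x -> in_image iota1 x.
Lemma in_image_horner_ext (g : {poly F}) u :
  in_image iota1 u -> in_image iota1 (map_poly iota g).[u].
Proof.
move=> hu; rewrite horner_coef; apply: in_image_sum => i.
apply: in_imageM; last exact: in_imageX.
by rewrite coef_map; apply/sub/in_image_map.
Qed.
End Horner.

Lemma sum_unity_root (L : fieldType) (p : nat) (w : L) : w ^+ p = 1 ->
  \sum_(j < p) w ^+ j = if w == 1 then p%:R else 0.
Proof.
move=> wp; case: eqVneq => [->|w1].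
  by under eq_bigr do rewrite expr1n; rewrite sumr_const card_ord.
move/eqP: (subrX1 w p); rewrite wp subrr eq_sym mulf_eq0 subr_eq0 (negPf w1).
by move/eqP.
Qed.
Lemma prim_root_exists (C : numClosedFieldType) n : (0 < n)%N ->
  exists z : C, n.-primitive_root z.
Proof.
move=> n_gt0; pose p : {poly C} := 'X^n - 1.
have [r Dp] := closed_field_poly_normal p.
rewrite (monicP _) ?monicXnsubC // scale1r in Dp.
have rn1 : all n.-unity_root r by apply/allP=> z; rewrite -root_prod_XsubC -Dp.
have sz_r : (n < (size r).+1)%N.
  by rewrite -(size_prod_XsubC r id) -Dp size_XnsubC.
have [|z prim_z] := hasP (has_prim_root n_gt0 rn1 _ sz_r); last by exists z.
by rewrite -separable_prod_XsubC -Dp separable_Xn_sub_1 // pnatr_eq0 -lt0n.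
Qed.

(** The multiplicative group of ['F_p] is cyclic. The generator is a natural number because it
    serves as an exponent of roots of unity. *)
Lemma prim_root_modp p : prime p -> exists t : nat,
  t ^ p.-1 = 1 %[mod p] /\
  forall j, (0 < j < p)%N -> exists i, j = t ^ i %[mod p].
Proof.
move=> p_prime; have p1_gt0 : (0 < p.-1)%N by rewrite -subn1 subn_gt0 prime_gt1.
have natE (m n : nat) : (m%:R == n%:R :> 'F_p) = (m == n %[mod p]).
  by rewrite -val_eqE /= !val_Fp_nat.
have unity (x : 'F_p) : x != 0 -> x ^+ p.-1 = 1.
  move=> x0; apply: (mulfI x0); rewrite -exprS prednK ?prime_gt0 // mulr1.
  by have := expf_card x; rewrite card_Fp.
pose rs := [seq x <- enum 'F_p | x != 0].
have rs1 : all p.-1.-unity_root rs.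
  by apply/allP => x; rewrite mem_filter unity_rootE => /andP[/unity -> _].
have rsu : uniq rs by rewrite filter_uniq // enum_uniq.
have srs : (p.-1 <= size rs)%N.
  rewrite size_filter -(leq_add2l (count (pred1 0) (enum 'F_p))) count_predC.
  rewrite -cardE card_Fp //; apply: (@leq_trans (1 + p.-1)); last first.
    by rewrite add1n prednK ?prime_gt0.
  by rewrite leq_add2r count_uniq_mem ?enum_uniq // leq_b1.
have [g _ prim_g] := hasP (has_prim_root p1_gt0 rs1 rsu srs).
have gE : g = (val g)%:R by rewrite /= natr_Zp.
exists (val g); split.
  by apply/eqP; rewrite -natE natrX -gE (prim_expr_order prim_g).
move=> j /andP[j_gt0 jp].
have [|i jE] := prim_rootP prim_g (x := j%:R).
  by apply: unity; rewrite -[0]/(0%:R) natE mod0n modn_small // -lt0n.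
by exists i; apply/eqP; rewrite -natE natrX -gE jE.
Qed.

(** An odd power determines both the sign and the absolute value. *)
Lemma real_exp_inj (R : numDomainType) (n : nat) (x y : R) : odd n -> x \is Num.real ->
  y \is Num.real -> x ^+ n = y ^+ n -> x = y.
Proof.
move=> n_odd xR yR xy; have n_gt0 : (0 < n)%N by case: n n_odd {xy}.
rewrite (realEsign xR) (realEsign yR) -(real_exprn_odd_lt0 xR n_odd) xy.
rewrite (real_exprn_odd_lt0 yR n_odd); congr (_ * _).
by apply: (pexpIrn n_gt0); rewrite ?nnegrE // -!normrX xy.
Qed.

(* The second clause says that [x] still has degree at least [q] over [F]. *)
Definition keeps_degree (C : numClosedFieldType) (q : nat) (x : C)
    (F : fieldType) (iota : {rmorphism F -> C}) : Prop :=
  (forall y, in_image iota y -> in_image iota y^*) /\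
  (forall g : {poly F}, (size g <= q)%N -> (map_poly iota g).[x] = 0 -> g = 0).

Section Kronecker.

Variables (C : numClosedFieldType) (q : nat) (f0 : {poly int}) (xs : 'I_q -> C).
Hypotheses (q_prime : prime q) (q_odd : odd q).
Hypothesis f0E : map_poly intr f0 = \prod_i ('X - (xs i)%:P).
Hypothesis power_sum : forall n, exists m : int, \sum_i xs i ^+ n = m%:~R.
Variables i0 i1 i2 i3 : 'I_q.
Hypotheses (real_i0 : xs i0 \is Num.real) (real_i1 : xs i1 \is Num.real).
Hypotheses (neq_i01 : i0 != i1) (neq_i23 : i2 != i3).
Hypothesis conj_i23 : (xs i2)^* = xs i3.

Local Notation good := (keeps_degree q (xs i0)).

Section Good.
Variables (F : fieldType) (iota : {rmorphism F -> C}).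
Hypothesis goodF : good iota.

Let f : {poly F} := map_poly intr f0.
Lemma fE : map_poly iota f = \prod_i ('X - (xs i)%:P).
Proof.
rewrite -f0E /f -map_poly_comp; apply: eq_map_poly => a /=.
by rewrite rmorph_int.
Qed.
Lemma size_f : size f = q.+1.
Proof.
rewrite -(size_map_poly iota) fE size_prod_XsubC.
by rewrite /index_enum -enumT size_enum_ord.
Qed.
Lemma f_neq0 : f != 0. Proof. by rewrite -size_poly_gt0 size_f. Qed.
Lemma f_root i : (map_poly iota f).[xs i] = 0.
Proof. by rewrite fE horner_prod (bigD1 i) //= hornerXsubC subrr mul0r. Qed.

(** [f] acts as the minimal polynomial of [xs i0]: the remainder of [g] modulo [f] has size at most
    [q] and vanishes at [xs i0], hence is zero. *)
Lemma good_root (g : {poly F}) i :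
  (map_poly iota g).[xs i0] = 0 -> (map_poly iota g).[xs i] = 0.
Proof.
rewrite (divp_eq g f) rmorphD rmorphM /= !hornerE f_root mulr0 add0r.
move=> /goodF.2 ->; last by rewrite -ltnS -size_f ltn_modpN0 ?f_neq0.
by rewrite f_root rmorph0 horner0 mulr0 addr0.
Qed.

Lemma good_root_eq (g h : {poly F}) i :
  (map_poly iota g).[xs i0] = (map_poly iota h).[xs i0] ->
  (map_poly iota g).[xs i] = (map_poly iota h).[xs i].
Proof.
move=> gh; apply/eqP; rewrite -subr_eq0 -hornerN -hornerD -rmorphB.
by apply/eqP/good_root; rewrite rmorphB /= !hornerE gh subrr.
Qed.

Lemma trace_in_image (g : {poly F}) :
  in_image iota (\sum_i (map_poly iota g).[xs i]).
Proof.
under eq_bigr do rewrite horner_coef.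
rewrite exchange_big /=; apply: in_image_sum => j.
rewrite -mulr_sumr; apply: in_imageM; first by rewrite coef_map; exact: in_image_map.
by have [m ->] := power_sum j; apply: in_image_int.
Qed.

Lemma conj_poly (g : {poly F}) : exists h : {poly F},
  forall x, ((map_poly iota g).[x])^* = (map_poly iota h).[x^*].
Proof.
have /fin_all_exists[h hE] (i : 'I_(size g)) : exists a, iota a = (iota g`_i)^*.
  by apply: goodF.1; apply: in_image_map.
exists (\poly_(i < size g) (if insub i is Some j then h j else 0)) => x.
rewrite horner_coef size_map_poly rmorph_sum /=.
rewrite (@horner_coef_wide _ (size g)) ?size_map_poly ?size_poly //.
apply: eq_bigr => i _; rewrite rmorphM rmorphXn /= !coef_map /= coef_poly ltn_ord.
by case: insubP => [j _ /val_inj ->|]; rewrite ?ltn_ord // hE.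
Qed.

Section Radical.
Variables (p : nat) (z u : C).
Hypotheses (p_prime : prime p) (prim_z : p.-primitive_root z).
Hypotheses (zF : in_image iota z) (upF : in_image iota (u ^+ p)).
Hypothesis uF : ~ in_image iota u.

(* For [0 < j < p] the trace of [g ^+ j] is a multiple of [u ^+ j] lying in [F],
   hence it vanishes; Fourier inversion then shows that each of the [p]
   conjugates of [u] is hit equally often by the [q] values of [g]. *)
Lemma radical_in_root_field (g : {poly F}) :
    u = (map_poly iota g).[xs i0] ->
  p = q /\ exists2 k : 'I_q -> 'I_p, injective k &
             forall i, (map_poly iota g).[xs i] = z ^+ k i * u.
Proof.
move=> ug; have u0 : u != 0.
  by apply/eqP => u0; apply: uF; rewrite u0; apply: in_image0.
have p_gt0 := prime_gt0 p_prime.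
have gp i : ((map_poly iota g).[xs i] / u) ^+ p = 1.
  have [a aE] := upF.
  have := @good_root_eq (g ^+ p) a%:P i.
  rewrite !rmorphXn !horner_exp map_polyC !hornerC /= -ug aE expr_div_n => -> //.
  by rewrite divff // expf_neq0.
pose k i := sval (prim_rootP prim_z (gp i)).
have kE i : (map_poly iota g).[xs i] = z ^+ k i * u.
  by rewrite -(svalP (prim_rootP prim_z (gp i))) divfK.
have sum0 (j : 'I_p) : (0 < j)%N -> \sum_i z ^+ (k i * j) = 0.
  move=> j_gt0; have [s sE] : in_image iota (\sum_i z ^+ (k i * j)).
    by apply: in_image_sum => i; apply: in_imageX.
  have [t tE] := trace_in_image (g ^+ j).
  have : s *: 'X^j - t%:P = 0.
    apply: (kummer_degree p_prime prim_z zF upF uF).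
      apply: leq_trans (size_polyD _ _) _; rewrite geq_max size_polyN.
      rewrite (leq_trans (size_scale_leq _ _)) ?size_polyXn //=.
      by rewrite (leq_trans (size_polyC_leq1 _)).
    rewrite rmorphB /= map_polyZ map_polyXn map_polyC !hornerE /= sE tE.
    rewrite mulr_suml -sumrB big1 // => i _.
    by rewrite rmorphXn horner_exp kE exprMn exprM subrr.
  move/(congr1 (fun h : {poly F} => h`_j)).
  rewrite coefB coefZ coefXn coefC eqxx gtn_eqF // mulr1 subr0 coef0 => s0.
  by rewrite -sE s0 rmorph0.
have cnt (l : 'I_p) : q = (p * #|[pred i | k i == l]|)%N.
  apply/eqP; rewrite -(eqr_nat C); apply/eqP.
  transitivity (\sum_(j < p) z ^+ ((p - l) * j) * \sum_i z ^+ (k i * j)).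
    rewrite (bigD1 (Ordinal p_gt0)) //= [X in _ + X]big1 ?addr0.
      rewrite muln0 mul1r (eq_bigr (fun=> 1)) ?sumr_const ?card_ord //.
      by move=> i _; rewrite muln0.
    by move=> j j0; rewrite sum0 ?mulr0 // lt0n.
  under eq_bigr do rewrite mulr_sumr.
  rewrite exchange_big /= natrM -sum1_card natr_sum mulr_sumr [RHS]big_mkcond /=.
  apply: eq_bigr => i _.
  transitivity (\sum_(j < p) (z ^+ (p - l + k i)) ^+ j).
    by apply: eq_bigr => j _; rewrite -!exprM -exprD mulnDl.
  rewrite sum_unity_root; last by rewrite exprAC (prim_expr_order prim_z) expr1n.
  have -> : (z ^+ (p - l + k i) == 1) = (k i == l).
    rewrite -[1](expr0 z) (eq_prim_root_expr prim_z) -(eqn_modDr l) addnAC subnK.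
      by rewrite add0n -modnDml modnn add0n !modn_small // val_eqE.
    by rewrite ltnW.
  by rewrite inE; case: eqP; rewrite ?mulr1 ?mulr0.
(* [cnt] makes the prime [p] divide the prime [q]; once they agree, every fibre of [k] is a single
   index. *)
have pq : p = q.
  apply/eqP; rewrite -dvdn_prime2 //; have := cnt (Ordinal p_gt0) => {1}->.
  exact: dvdn_mulr.
split=> //; exists k => // i j kij.
have /eqP := cnt (k i); rewrite -{1}pq -{1}[p]muln1 eqn_pmul2l // eq_sym.
case/card1P=> x xE; have := xE i; have := xE j.
by rewrite !inE kij eqxx => /esym/eqP -> /esym/eqP ->.
Qed.

Lemma radical_not_in_root_field (g : {poly F}) :
  u \is Num.real \/ in_image iota (u * u^*) ->
  u <> (map_poly iota g).[xs i0].
Proof.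
move=> hu ug; have [pq [k k_inj kE]] := radical_in_root_field ug.
have u0 : u != 0.
  by apply/eqP => u0; apply: uF; rewrite u0; apply: in_image0.
have g_inj i j : (map_poly iota g).[xs i] = (map_poly iota g).[xs j] -> i = j.
  rewrite !kE => /(mulIf u0) /eqP.
  by rewrite (eq_prim_root_expr prim_z) !modn_small // => /eqP/val_inj/k_inj.
have [h hE] := conj_poly g.
have z_norm i : (z ^+ i) * (z ^+ i)^* = 1.
  rewrite -normCK normrX (_ : `|z| = 1) ?expr1n //.
  apply/eqP; rewrite -(@pexpr_eq1 _ _ p) ?prime_gt0 // -normrX.
  by rewrite (prim_expr_order prim_z) normr1.
case: hu => [u_real|[c cE]].
  have odd_p : odd p by rewrite pq.
  (* Since [u] and [xs i0] are real, [g] and its conjugate [h] agree at [xs i0], hence at every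
     root. So [g] is real at both real roots, with equal odd [p]-th powers, and the two values
     coincide. *)
  have gh i : (map_poly iota h).[xs i] = (map_poly iota g).[xs i].
    apply: good_root_eq; rewrite -[in LHS](CrealP real_i0) -hE -ug.
    exact/CrealP.
  have := neq_i01; rewrite (g_inj i0 i1) ?eqxx //.
  apply: (@real_exp_inj C p); [by rewrite pq | by rewrite -ug | |].
    by apply/CrealP; rewrite hE (CrealP real_i1) gh.
  by rewrite !kE !exprMn ![(z ^+ _) ^+ p]exprAC (prim_expr_order prim_z) !expr1n.
(* At [xs i2] this says that g(xs i2) times the conjugate of g(xs i3) is |u|^2, which is also |g(xs
   i2)|^2; so [g] takes equal values at [xs i2] and [xs i3]. *)
have gh i : (map_poly iota (g * h)).[xs i] = u * u^*.
  rewrite -cE -[RHS](hornerC _ (xs i)) -map_polyC; apply: good_root_eq.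
  rewrite map_polyC hornerC /= cE rmorphM hornerM -ug; congr (_ * _).
  by rewrite /= [in RHS]ug hE (CrealP real_i0).
have := neq_i23; rewrite (g_inj i3 i2) ?eqxx //.
apply: (can_inj (@conjCK C)).
have := gh i2; rewrite rmorphM hornerM /= -[in X in _ * X](conjCK (xs i2)) -hE conj_i23.
have /eqP := z_norm (k i2).
have g2 : (map_poly iota g).[xs i2] != 0.
  by rewrite kE mulf_neq0 // expf_neq0 // (prim_root_eq0 prim_z) -lt0n prime_gt0.
move=> /eqP zn h2; apply: (mulfI g2); rewrite h2 kE rmorphM mulrACA zn.
by rewrite mul1r.
Qed.

End Radical.
Definition extends_to (x : C) : Prop :=
  exists (F1 : fieldType) (iota1 : {rmorphism F1 -> C}), [/\ good iota1,
    forall y, in_image iota y -> in_image iota1 y & in_image iota1 x].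

Lemma extends_in x : in_image iota x -> extends_to x.
Proof. by move=> xF; exists F, iota. Qed.

(** By [radical_not_in_root_field], [u] lies outside F(xs i0), so by [kummer_degree] the powers of
    [u] below [p] are independent over that field. A relation of degree below [q] for [xs i0] over
    F(u) therefore splits into relations over [F], all trivial. Stability under conjugation holds
    since the conjugate of [u] is [u] or |u|^2 / u. *)
Lemma extends_radical p z u : prime p -> p.-primitive_root z ->
  in_image iota z -> in_image iota (u ^+ p) ->
  u \is Num.real \/ in_image iota (u * u^*) -> extends_to u.
Proof.
move=> p_prime prim_z zF upF hu.
have [|uF] := classic (in_image iota u); first exact: extends_in.
have p_gt0 := prime_gt0 p_prime; have [a aE] := upF.
pose m : {poly F} := 'X^p - a%:P.
have sm : size m = p.+1 by apply: size_XnsubC.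
have m0 : m != 0 by rewrite -size_poly_gt0 sm.
have mu : (map_poly iota m).[u] = 0.
  by rewrite rmorphB /= map_polyXn map_polyC !hornerE /= aE subrr.
have [F1 [iota1 im1]] := adjoin_root m0 mu.
have sub1 x : in_image iota x -> in_image iota1 x.
  case=> b <-; apply/im1; exists b%:P; last by rewrite map_polyC hornerC.
  by rewrite sm (leq_ltn_trans (size_polyC_leq1 _)) // ltnS.
have u1 : in_image iota1 u.
  apply/im1; exists 'X; last by rewrite map_polyX hornerX.
  by rewrite size_polyX sm ltnS prime_gt1.
have u1c : in_image iota1 u^*.
  case: hu => [/CrealP-> //|/sub1 uc].
  have [->|u0] := eqVneq u 0; first by rewrite rmorph0; apply: in_image0.
  by move: (in_image_div uc u1); rewrite mulrAC divff // mul1r.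
exists F1, iota1; split=> //; split.
  move=> x /im1[g _ ->]; have [h ->] := conj_poly g.
  exact: in_image_horner_ext.
move=> h sh hx.
have fx := f_root i0.
have [F0 [iota0 im0]] := adjoin_root f_neq0 fx.
have sub0 x : in_image iota x -> in_image iota0 x.
  case=> b <-; apply/im0; exists b%:P; last by rewrite map_polyC hornerC.
  by rewrite size_f (leq_ltn_trans (size_polyC_leq1 _)) // ltnS prime_gt0.
have uF0 : ~ in_image iota0 u.
  case/im0=> g _; exact: (radical_not_in_root_field p_prime prim_z).
have /fin_all_exists2[g sg gE] (i : 'I_q) : exists2 g : {poly F},
    (size g <= p)%N & iota1 h`_i = (map_poly iota g).[u].
  by have /im1[g] := in_image_map iota1 h`_i; rewrite sm ltnS; exists g.
have /fin_all_exists[c cE] (j : 'I_p) : exists c : F0,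
    iota0 c = \sum_(i < q) iota (g i)`_j * xs i0 ^+ i.
  apply: in_image_sum => i; apply: in_imageM.
    by apply/sub0/in_image_map.
  apply: in_imageX; apply/im0; exists 'X; last by rewrite map_polyX hornerX.
  by rewrite size_polyX size_f ltnS prime_gt1.
(* [G] is the relation [h] regrouped by powers of [u], with coefficients in F(xs i0). *)
pose G : {poly F0} := \poly_(j < p) (if insub j is Some j' then c j' else 0).
have G0 : G = 0.
  apply: (kummer_degree p_prime prim_z (sub0 _ zF) (sub0 _ upF) uF0).
    exact: size_poly.
  rewrite (@horner_coef_wide _ p) ?size_map_poly ?size_poly //.
  rewrite -[RHS]hx (@horner_coef_wide _ q) ?size_map_poly //.
  under [RHS]eq_bigr => i _ do
    rewrite coef_map /= gE (@horner_coef_wide _ p) ?size_map_poly // mulr_suml.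
  rewrite exchange_big /=; apply: eq_bigr => j _.
  rewrite coef_map coef_poly ltn_ord.
  case: insubP => [j' _ /val_inj ->|]; rewrite ?ltn_ord //= cE mulr_suml.
  by apply: eq_bigr => i _; rewrite coef_map mulrAC.
have g0 (j : 'I_p) : \poly_(i < q) (if insub i is Some i' then (g i')`_j else 0) = 0.
  apply: goodF.2; first exact: size_poly.
  rewrite (@horner_coef_wide _ q) ?size_map_poly ?size_poly //.
  transitivity (iota0 G`_j); last by rewrite G0 coef0 rmorph0.
  rewrite coef_poly ltn_ord; case: insubP => [j' _ /val_inj ->|]; rewrite ?ltn_ord //.
  rewrite cE; apply: eq_bigr => i _; rewrite coef_map coef_poly ltn_ord.
  by case: insubP => [i' _ /val_inj ->|]; rewrite ?ltn_ord.
apply/polyP => i; rewrite coef0; case: (ltnP i q) => iq; last first.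
  by rewrite nth_default // (leq_trans sh).
apply: (fmorph_inj iota1); rewrite rmorph0 (gE (Ordinal iq)).
rewrite (_ : g _ = 0) ?rmorph0 ?horner0 //; apply/polyP => j; rewrite coef0.
case: (ltnP j p) => jp; last by rewrite nth_default // (leq_trans (sg _)).
have := congr1 (fun h : {poly F} => h`_i) (g0 (Ordinal jp)).
by rewrite coef_poly iq insubT coef0.
Qed.

End Good.
Lemma extends_toW (F F1 : fieldType) (iota : {rmorphism F -> C})
    (iota1 : {rmorphism F1 -> C}) x :
  (forall y, in_image iota y -> in_image iota1 y) ->
  extends_to iota1 x -> extends_to iota x.
Proof.
by move=> sub [F2 [iota2 [? sub2 ?]]]; exists F2, iota2; split=> // y /sub/sub2.
Qed.

Definition root_closed (k : nat) : Prop :=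
  forall (F : fieldType) (iota : {rmorphism F -> C}) w, good iota ->
  in_image iota (w ^+ k) -> extends_to iota w.

Lemma root_closed_seq k (s : seq C) (F : fieldType) (iota : {rmorphism F -> C}) :
  root_closed k -> good iota -> (forall w, w \in s -> in_image iota (w ^+ k)) ->
  exists (F1 : fieldType) (iota1 : {rmorphism F1 -> C}), [/\ good iota1,
    forall y, in_image iota y -> in_image iota1 y &
    forall w, w \in s -> in_image iota1 w].
Proof.
move=> rk; elim: s F iota => [|x s IHs] F iota goodF sk; first by exists F, iota.
have [|F1 [iota1 [good1 sub1 x1]]] := rk _ iota x goodF.
  by apply: sk; rewrite mem_head.
have [|F2 [iota2 [good2 sub2 s2]]] := IHs _ iota1 good1.
  by move=> w ws; apply/sub1/sk; rewrite inE ws orbT.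
exists F2, iota2; split=> // [y /sub1/sub2 //|w].
by rewrite inE => /orP[/eqP -> |/s2 //]; apply: sub2.
Qed.

(* Each Lagrange resolvent [R s z] has its power [B z = R s z ^+ p.-1] invariant
   under [z := z ^+ t], so summing [B] over all [p]-th roots of unity shows that
   [B z] lies in the ground field, and [z] is the mean of its resolvents. *)
Lemma extends_unity_root p z (F : fieldType) (iota : {rmorphism F -> C}) :
  prime p -> p.-primitive_root z -> root_closed p.-1 -> good iota ->
  extends_to iota z.
Proof.
move=> p_prime prim_z rp goodF.
have p1_gt0 : (0 < p.-1)%N by rewrite -subn1 subn_gt0 prime_gt1.
have zp := prim_expr_order prim_z.
have [o prim_o] := prim_root_exists C p1_gt0.
have op := prim_expr_order prim_o.
have [|F1 [iota1 [good1 sub1 [o' oE]]]] := rp _ iota o goodF.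
  by rewrite op; apply: in_image_nat 1%N.
have [t [tp t_gen]] := prim_root_modp p_prime.
(* The resolvent as a polynomial over [F1], so that its powers can be summed over the roots of unity
   coefficientwise. *)
pose Q (s : nat) : {poly F1} := \sum_(i < p.-1) o' ^+ (s * i) *: 'X^(t ^ i).
pose R s (x : C) := \sum_(i < p.-1) o ^+ (s * i) * x ^+ (t ^ i).
have QE s x : (map_poly iota1 (Q s)).[x] = R s x.
  rewrite rmorph_sum horner_sum; apply: eq_bigr => i _ /=.
  by rewrite map_polyZ map_polyXn !hornerE rmorphXn /= oE.
have expz (x : C) (i j : nat) : x ^+ p = 1 -> i = j %[mod p] -> x ^+ i = x ^+ j.
  by move=> xp ij; rewrite -(expr_mod i xp) ij expr_mod.
(* The factor [o ^+ s] undoes the shift of the summation index; the last term wraps around to the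
   first because [t ^ p.-1] is 1 modulo [p]. *)
have Rt s x : x ^+ p = 1 -> o ^+ s * R s (x ^+ t) = R s x.
  move=> xp; rewrite /R mulr_sumr.
  under eq_bigr do rewrite mulrA -exprD -mulnS -exprM -expnS.
  case: (p.-1) p1_gt0 op tp => // m _ om tm.
  rewrite big_ord_recr [RHS]big_ord_recl /= addrC muln0 expr0 mulnC exprM om.
  by rewrite expr1n (expz x _ (t ^ 0)%N) // expn0.
have Bt s x : x ^+ p = 1 -> R s (x ^+ t) ^+ p.-1 = R s x ^+ p.-1.
  by move=> xp; rewrite -(Rt s x xp) exprMn exprAC op expr1n mul1r.
have Bti s i : R s (z ^+ (t ^ i)) ^+ p.-1 = R s z ^+ p.-1.
  elim: i => [|i IHi]; first by rewrite expn0.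
  by rewrite expnSr exprM Bt // exprAC zp expr1n.
have B1 s : in_image iota1 (R s z ^+ p.-1).
  have sumB : in_image iota1 (\sum_(j < p) R s (z ^+ j) ^+ p.-1).
    under eq_bigr do rewrite -QE -horner_exp -rmorphXn horner_coef.
    rewrite exchange_big /=; apply: in_image_sum => n; rewrite -mulr_sumr.
    apply: in_imageM; first by rewrite coef_map; apply: in_image_map.
    under eq_bigr do rewrite exprAC.
    rewrite sum_unity_root; last by rewrite exprAC zp expr1n.
    by case: ifP => _; [apply: in_image_nat | apply: in_image0].
  have p_gt0 := prime_gt0 p_prime.
  have B0 : in_image iota1 (R s 1 ^+ p.-1).
    by rewrite -QE; apply/in_imageX/in_image_horner/(in_image_nat iota1 1).
  (* For [0 < j < p] the power [z ^+ j] is some [z ^+ (t ^ i)], so all terms but the one at [j = 0]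
     are equal. *)
  have : in_image iota1 (R s z ^+ p.-1 * p.-1%:R).
    rewrite (_ : _ * _ = \sum_(j < p) R s (z ^+ j) ^+ p.-1 - R s 1 ^+ p.-1).
      exact: in_imageB.
    rewrite (bigD1 (Ordinal p_gt0)) //= expr0 addrAC subrr add0r.
    rewrite (eq_bigr (fun=> R s z ^+ p.-1)); last first.
      move=> j j0; have [|i /(expz z _ _ zp) ->] := t_gen j; last exact: Bti.
      by rewrite ltn_ord lt0n andbT.
    by rewrite sumr_const cardC1 card_ord mulr_natr.
  move/in_image_div/(_ (in_image_nat _ p.-1)); rewrite mulfK //.
  by rewrite pnatr_eq0 -lt0n.
have [|F2 [iota2 [good2 sub2 R2]]] :=
  @root_closed_seq p.-1 [seq R s z | s <- index_iota 0 p.-1] _ iota1 rp good1.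
  by move=> w /mapP[s _ ->].
exists F2, iota2; split=> // [y /sub1/sub2 //|].
rewrite (_ : z = (\sum_(s < p.-1) R s z) / p.-1%:R).
  apply: in_image_div; last exact: in_image_nat.
  apply: in_image_sum => s; apply: R2; apply/map_f.
  by rewrite mem_index_iota ltn_ord.
rewrite /R exchange_big /=.
rewrite (bigD1 (Ordinal p1_gt0)) //= [X in _ + X]big1 ?addr0.
  rewrite (eq_bigr (fun=> z)) => [|s _]; last by rewrite muln0 expr0 mul1r expn0.
  by rewrite sumr_const card_ord -[z *+ _]mulr_natr mulfK // pnatr_eq0 -lt0n.
move=> i i_neq0; rewrite -mulr_suml.
under eq_bigr do rewrite mulnC exprM.
rewrite sum_unity_root; last by rewrite exprAC op expr1n.
rewrite -[1](expr0 o) (eq_prim_root_expr prim_o) mod0n modn_small //.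
by rewrite -val_eqE /= in i_neq0; rewrite (negPf i_neq0) mul0r.
Qed.

(** Strong induction on [k]. A composite exponent is split by its smallest prime factor. For a prime
    [p], a primitive root of unity comes first, using the case [p.-1]; then the real number |w|^2,
    whose [p]-th power lies in the field by stability under conjugation; then [w]. *)
Lemma root_closed_gt0 k : (0 < k)%N -> root_closed k.
Proof.
elim/ltn_ind: k => k IHk k_gt0 F iota w goodF wk.
have [k_le1|k_gt1] := leqP k 1.
  by apply: extends_in => //; rewrite (_ : k = 1%N) in wk; last by apply/eqP; rewrite eqn_leq k_le1.
have p_prime := pdiv_prime k_gt1; set p := pdiv k in p_prime.
have p_gt0 := prime_gt0 p_prime.
have kE : k = (p * (k %/ p))%N by rewrite mulnC divnK // pdiv_dvd.
have [pk|pk] := eqVneq p k; last first.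
  have pk' : (p < k)%N by rewrite ltn_neqAle pk dvdn_leq // pdiv_dvd.
  have [|||F1 [iota1 [good1 sub1 w1]]] := IHk (k %/ p)%N _ _ _ iota (w ^+ p) goodF.
  - by rewrite ltn_Pdiv // prime_gt1.
  - by rewrite divn_gt0 // ltnW.
  - by rewrite -exprM -kE.
  by apply: (extends_toW sub1); apply: (IHk p).
rewrite -pk in wk IHk; have [z prim_z] := prim_root_exists C p_gt0.
have rp : root_closed p.-1.
  by apply: IHk; rewrite ?prednK // -subn1 subn_gt0 prime_gt1.
have [F2 [iota2 [good2 sub2 z2]]] := extends_unity_root p_prime prim_z rp goodF.
apply: (extends_toW sub2).
have wp2 := sub2 _ wk; pose u := w * w^*.
have u_real : u \is Num.real by rewrite /u -normCK realX ?normr_real.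
have [|F3 [iota3 [good3 sub3 u3]]] :=
  extends_radical good2 p_prime prim_z z2 (u := u) _ (or_introl u_real).
  rewrite exprMn -rmorphXn; apply: in_imageM => //.
  exact: good2.1.
apply: (extends_toW sub3).
apply: (extends_radical good3 p_prime prim_z (sub3 _ z2) (sub3 _ wp2)).
by right.
Qed.

End Kronecker.

(** * The quintic [X^5 - 5X^3 + 7X - 2] *)

(** Stated over any ring, so that [quintic 'X] is the polynomial and [quintic x] its value. *)
Definition quintic (R : pzRingType) (x : R) : R :=
  x ^+ 5 - 5%:R * x ^+ 3 + 7%:R * x - 2%:R.

Lemma rmorph_quintic (R S : pzRingType) (h : {rmorphism R -> S}) x :
  h (quintic x) = quintic (h x).
Proof.
by rewrite /quintic !(rmorphB, rmorphD, rmorphM, rmorphXn, rmorph_nat) /= rmorph1.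
Qed.

Lemma map_poly_quintic (R S : nzRingType) (h : {rmorphism R -> S}) :
  map_poly h (quintic 'X) = quintic 'X.
Proof. by rewrite rmorph_quintic /= map_polyX. Qed.

Lemma horner_quintic (R : comNzRingType) (x : R) : (quintic 'X).[x] = quintic x.
Proof.
by rewrite /quintic !hornerE /=; ring.
Qed.

Lemma quintic_polyE (R : nzRingType) :
  quintic 'X = Poly [:: - 2%:R; 7%:R; 0; - 5%:R; 0; 1] :> {poly R}.
Proof.
apply/polyP => i; rewrite /quintic coef_Poly -!polyC_natr.
rewrite !(coefB, coefD, coefCM, coefXn, coefX, coefC).
by case: i => [|[|[|[|[|[|i]]]]]] /=;
  rewrite ?nth_nil ?mulr0 ?mulr1 ?subr0 ?addr0 ?add0r ?sub0r.
Qed.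

Lemma size_quintic (R : nzRingType) : size (quintic 'X : {poly R}) = 6%N.
Proof. by rewrite quintic_polyE (@PolyK _ 0) //= oner_eq0. Qed.

Lemma int_factor_bound (a c b : int) : b != 0 -> a * c = b -> (`|a| <= `|b|)%N.
Proof.
move=> b0 ac; apply: dvdn_leq; first by rewrite absz_gt0.
by rewrite -ac abszM dvdn_mulr.
Qed.

Lemma int_mul_eq1 (a c : int) : a * c = 1 -> a = 1 /\ c = 1 \/ a = -1 /\ c = -1.
Proof.
move=> ac; have : a = -1 \/ a = 0 \/ a = 1.
  by have /= := @int_factor_bound a c 1 isT ac; lia.
by case=> [|[]] ae; rewrite ae in ac *; lia.
Qed.

Lemma int_mul_eqN2 (a c : int) : a * c = -2 ->
  a = 1 /\ c = -2 \/ a = -1 /\ c = 2 \/ a = 2 /\ c = -1 \/ a = -2 /\ c = 1.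
Proof.
move=> ac; have : a = -2 \/ a = -1 \/ a = 0 \/ a = 1 \/ a = 2.
  by have /= := @int_factor_bound a c (-2) isT ac; lia.
by case=> [|[|[|[]]]] ae; rewrite ae in ac *; lia.
Qed.

Lemma quintic_factor_size (g h : {poly int}) :
  quintic 'X = g * h -> (size g + size h = 7)%N.
Proof.
move=> E; have q0 : quintic 'X != 0 :> {poly int} by rewrite -size_poly_gt0 size_quintic.
have g0 : g != 0 by apply: contra_neq q0 => g0; rewrite E g0 mul0r.
have h0 : h != 0 by apply: contra_neq q0 => h0; rewrite E h0 mulr0.
have := size_quintic int; rewrite E size_mul //; move: g0; rewrite -!size_poly_gt0.
by case: (size g) => // n _; rewrite !addSn /= => ->.
Qed.

Lemma quintic_no_small_factor (g h : {poly int}) :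
  quintic 'X = g * h -> (size g <= 3)%N -> size g = 1%N.
Proof.
move=> E sg.
have sgh := quintic_factor_size E.
have ge i : (size g <= i)%N -> g`_i = 0 by move=> ?; rewrite nth_default.
have he i : (size h <= i)%N -> h`_i = 0 by move=> ?; rewrite nth_default.
have s1 : (0 < size g)%N.
  have q0 : quintic 'X != 0 :> {poly int} by rewrite -size_poly_gt0 size_quintic.
  by rewrite size_poly_gt0; apply: contra_neq q0 => g0; rewrite E g0 mul0r.
have cf k : (quintic 'X)`_k = \sum_(j < k.+1) g`_j * h`_(k - j) by rewrite E coefM.
have := cf 0%N; have := cf 1%N; have := cf 2%N; have := cf 3%N; have := cf 4%N; have := cf 5%N.
rewrite quintic_polyE !coef_Poly /= !big_ord_recr !big_ord0 /= !subn0 /= => {cf E}.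
rewrite !(subSS, subn0, subnn).
have [//|s2] := eqVneq (size g) 1%N.
rewrite (ge 3%N) ?(ge 4%N) ?(ge 5%N) ?(he 5%N); try lia.
move: (g`_0) (g`_1) (g`_2) (h`_0) (h`_1) (h`_2) (h`_3) (h`_4) (ge 2%N) (he 4%N)
  => g0' g1 g2 h0' h1 h2 h3 h4 G2 H4.
(* Either [g] is linear, or it is quadratic with a cubic cofactor. The leading coefficients multiply
   to 1 and the constant ones to -2, which leaves finitely many cases. *)
have [g2e|h4e] : g2 = 0 \/ h4 = 0.
  by have [/G2 ->|] := leqP (size g) 2; [left | move=> ?; right; apply: H4; lia].
- rewrite g2e !mul0r !addr0 !mulr0 !add0r => c5 c4 c3 c2 c1 c0.
  exfalso; move: c4 c3 c2 c1; have := int_mul_eq1 (esym c5); have := int_mul_eqN2 (esym c0).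
  by case=> [[-> ->]|[[-> ->]|[[-> ->]|[-> ->]]]] [[-> ->]|[-> ->]]; lia.
- rewrite h4e !mul0r !mulr0 !addr0 !add0r => c5 c4 c3 c2 c1 c0.
  exfalso; move: c4 c3 c2 c1; have := int_mul_eq1 (esym c5); have := int_mul_eqN2 (esym c0).
  case=> [[-> ->]|[[-> ->]|[[-> ->]|[-> ->]]]] [[-> ->]|[-> ->]] c4 c3 c2 c1.
  all: have h2E : h2 = - g1 by lia.
  all: rewrite {}h2E in c3 c2.
  (* The middle coefficient of [g] is bounded, then shifted to a natural number so that its thirteen
     values can be tried in turn. *)
  all: have [lo hi] : -6 <= g1 /\ g1 <= 6 by split; nia.
  all: have [k g1E] : exists k : nat, g1 = k%:Z - 6 by exists (absz (g1 + 6)); lia.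
  all: have {lo hi} : (k <= 12)%N by lia.
  all: rewrite {}g1E in c1 c2 c3; do 13 (case: k c1 c2 c3 => [|k] c1 c2 c3; first by lia).
  all: by [].
Qed.

(** By Gauss's lemma it suffices to factor over the integers, where one of the two factors has
    degree at most 2. *)
Lemma quintic_irreducible : irreducible_poly (quintic 'X : {poly rat}).
Proof.
rewrite -(map_poly_quintic intr); apply/irreducible_rat_int.
split=> [|g sg gq]; first by rewrite size_quintic.
rewrite -dvdp_size_eqp // size_quintic.
have [h E] := dvdpP_int gq; have := quintic_factor_size E; rewrite -(size_zprimitive g) in sg *.
have [g_le3|g_gt3] := leqP (size (zprimitive g)) 3.
  by move: sg; rewrite (quintic_no_small_factor E g_le3).
move=> sgh; have sh : size h = 1%N; last first.
  by move: sgh; rewrite sh addn1 => -[->].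
apply: (@quintic_no_small_factor h (zprimitive g)); first by rewrite mulrC.
by rewrite -(leq_add2l (size (zprimitive g))) sgh -[7%N]/(4 + 3)%N leq_add2r.
Qed.

Section QuinticRoots.
Variable C : numClosedFieldType.

Lemma quintic_roots : exists xs : 'I_5 -> C,
  map_poly intr (quintic 'X : {poly int}) = \prod_i ('X - (xs i)%:P).
Proof.
have [r rE] := closed_field_poly_normal (quintic 'X : {poly C}).
have lq : lead_coef (quintic 'X : {poly C}) = 1.
  by rewrite lead_coefE size_quintic quintic_polyE coef_Poly.
rewrite lq scale1r in rE.
have sr : size r = 5%N.
  by apply/eqP; rewrite -eqSS -(size_prod_XsubC r id) -rE size_quintic.
exists (fun i => r`_i); rewrite map_poly_quintic rE (big_nth 0) sr.
by rewrite big_mkord.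
Qed.

Variable xs : 'I_5 -> C.
Hypothesis xsE : map_poly intr (quintic 'X : {poly int}) = \prod_i ('X - (xs i)%:P).

Lemma quinticE t : quintic t = \prod_i (t - xs i).
Proof.
rewrite -horner_quintic -(map_poly_quintic intr) xsE horner_prod.
by apply: eq_bigr => i _; rewrite hornerXsubC.
Qed.

Lemma quintic_root i : quintic (xs i) = 0.
Proof. by rewrite quinticE (bigD1 i) //= subrr mul0r. Qed.

Lemma quintic_power_sumS n :
  \sum_i xs i ^+ (n + 5) = 5%:R * (\sum_i xs i ^+ (n + 3))
    - 7%:R * (\sum_i xs i ^+ (n + 1)) + 2%:R * \sum_i xs i ^+ n.
Proof.
rewrite !mulr_sumr -sumrB -big_split /=; apply: eq_bigr => i _.
have x5 : xs i ^+ 5 = 5%:R * xs i ^+ 3 - 7%:R * xs i + 2%:R.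
  apply/eqP; rewrite -subr_eq0 -(quintic_root i) /quintic; apply/eqP; ring.
by rewrite !exprD x5; ring.
Qed.

(** Newton's identities. The elementary symmetric functions [e1] to [e5] are read off from the
    values of the quintic at -2, -1, 0, 1, 2. *)
Lemma quintic_power_sums : [/\ \sum_i xs i = 0, \sum_i xs i ^+ 2 = 10%:R,
  \sum_i xs i ^+ 3 = 0 & \sum_i xs i ^+ 4 = 22%:R].
Proof.
have := quinticE 0; have := quinticE 1; have := quinticE (-1).
have := quinticE 2%:R; have := quinticE (- 2%:R).
rewrite !big_ord_recl !big_ord0 /=.
move: (xs _) (xs _) (xs _) (xs _) (xs _) => a b c d e.
rewrite !mulr1.
set Pm2 := (X in quintic (- 2%:R) = X); set P2 := (X in quintic 2%:R = X).
set Pm1 := (X in quintic (- 1) = X); set P1 := (X in quintic 1 = X).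
set P0 := (X in quintic 0 = X) => Em2 E2 Em1 E1 E0.
pose e1 := a + b + c + d + e.
pose e2 := a*b + a*c + a*d + a*e + b*c + b*d + b*e + c*d + c*e + d*e.
pose e3 := a*b*c+a*b*d+a*b*e+a*c*d+a*c*e+a*d*e+b*c*d+b*c*e+b*d*e+c*d*e.
pose e4 := b*c*d*e+a*c*d*e+a*b*d*e+a*b*c*e+a*b*c*d.
pose e5 := a*b*c*d*e.
have cancel (n : nat) (x y : C) : n.+1%:R * x = n.+1%:R * y -> x = y.
  by apply: mulfI; rewrite pnatr_eq0.
(* The fourth central difference of these values is -24 [e1]. *)
have e1E : e1 = 0.
  apply: (@cancel 23); transitivity (- (P2 - 4%:R * P1 + 6%:R * P0 - 4%:R * Pm1 + Pm2)).
    by rewrite /e1 /P2 /P1 /P0 /Pm1 /Pm2; ring.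
  by rewrite -Em2 -E2 -Em1 -E1 -E0 /quintic; ring.
have e5E : e5 = 2%:R.
  transitivity (- P0); first by rewrite /e5 /P0; ring.
  by rewrite -E0 /quintic; ring.
have e3E : e3 = 0.
  apply: (@cancel 1); transitivity (- (P1 + Pm1) - 2%:R * e1 - 2%:R * e5).
    by rewrite /e1 /e3 /e5 /P1 /Pm1; ring.
  by rewrite -Em1 -E1 e1E e5E /quintic; ring.
have e2E : e2 = - 5%:R.
  apply: (@cancel 11); transitivity (P2 - Pm2 - 2%:R * (P1 - Pm1) - 60%:R).
    by rewrite /e2 /P2 /Pm2 /P1 /Pm1; ring.
  by rewrite -Em2 -E2 -Em1 -E1 /quintic; ring.
have e4E : e4 = 7%:R.
  apply: (@cancel 1); transitivity (P1 - Pm1 - 2%:R - 2%:R * e2).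
    by rewrite /e2 /e4 /P1 /Pm1; ring.
  by rewrite -Em1 -E1 e2E /quintic; ring.
split.
- by transitivity e1 => //; rewrite /e1; ring.
- transitivity (e1 ^+ 2 - 2%:R * e2); first by rewrite /e1 /e2; ring.
  by rewrite e1E e2E; ring.
- transitivity (e1 ^+ 3 - 3%:R * e1 * e2 + 3%:R * e3).
    by rewrite /e1 /e2 /e3; ring.
  by rewrite e1E e3E; ring.
- transitivity (e1 ^+ 4 - 4%:R * e1 ^+ 2 * e2 + 2%:R * e2 ^+ 2
                + 4%:R * e1 * e3 - 4%:R * e4).
    by rewrite /e1 /e2 /e3 /e4; ring.
  by rewrite e1E e2E e4E; ring.
Qed.

Lemma quintic_power_sum_int n : exists m : int, \sum_i xs i ^+ n = m%:~R.
Proof.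
have [S1 S2 S3 S4] := quintic_power_sums.
elim/ltn_ind: n => -[|[|[|[|[|n]]]]] IHn.
- by exists 5; under eq_bigr do rewrite expr0; rewrite sumr_const card_ord.
- by exists 0; under eq_bigr do rewrite expr1; rewrite S1.
- by exists 10; rewrite S2.
- by exists 0; rewrite S3.
- by exists 22; rewrite S4.
have [|m3 E3] := IHn (n + 3)%N; first by lia.
have [|m1 E1] := IHn (n + 1)%N; first by lia.
have [|m0 E0] := IHn n; first by lia.
exists (5 * m3 - 7 * m1 + 2 * m0); rewrite (_ : n.+4.+1 = n + 5)%N; last by lia.
rewrite quintic_power_sumS E3 E1 E0.
by rewrite !(rmorphD, rmorphN, rmorphM).
Qed.

(* If all roots were real, [\sum_i (xs i * (xs i ^+ 2 - 2)) ^+ 2 = -8] would be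
   nonnegative. *)
Lemma quintic_nonreal_root : exists i, xs i \isn't Num.real.
Proof.
have [S1 S2 S3 S4] := quintic_power_sums; apply: NNPP => no_nonreal.
have real_xs i : xs i \is Num.real.
  by apply/negPn/negP => nr; apply: no_nonreal; exists i.
have S6 : \sum_i xs i ^+ 6 = 40%:R.
  have := quintic_power_sumS 1; rewrite S4 S2.
  by under [\sum_i _ ^+ 1]eq_bigr do rewrite expr1; rewrite S1 => ->; ring.
have : 0 <= \sum_i (xs i * (xs i ^+ 2 - 2%:R)) ^+ 2.
  apply: sumr_ge0 => i _; rewrite real_exprn_even_ge0 //.
  by rewrite rpredM ?rpredB ?rpredX // realn.
rewrite (_ : \sum_i _ = - 8%:R); first by rewrite oppr_ge0 lern0.
transitivity (\sum_i xs i ^+ 6 - 4%:R * (\sum_i xs i ^+ 4) + 4%:R * \sum_i xs i ^+ 2).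
  by rewrite !mulr_sumr -sumrB -big_split; apply: eq_bigr => i _ /=; ring.
by rewrite S6 S4 S2; ring.
Qed.

End QuinticRoots.

(** * Radical extensions and computation trees avoid the roots of the quintic *)

Section NotRadical.
Variable C : numClosedFieldType.

Lemma quintic_root_index (xs : 'I_5 -> C) x :
  map_poly intr (quintic 'X : {poly int}) = \prod_i ('X - (xs i)%:P) ->
  quintic x = 0 -> exists i, xs i = x.
Proof.
move=> xsE; rewrite (quinticE xsE) => /eqP/prodf_eq0[i _].
by rewrite subr_eq0 => /eqP ->; exists i.
Qed.

Variables r0 r1 : C.
Hypotheses (r0R : r0 \is Num.real) (r1R : r1 \is Num.real) (r01 : r0 != r1).
Hypotheses (q0 : quintic r0 = 0) (q1 : quintic r1 = 0).

Lemma keeps_degree_root (F : fieldType) (iota : {rmorphism F -> C}) k w :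
  keeps_degree 5 r0 iota -> (0 < k)%N -> in_image iota (w ^+ k) ->
  exists (F1 : fieldType) (iota1 : {rmorphism F1 -> C}), [/\ keeps_degree 5 r0 iota1,
    forall y, in_image iota y -> in_image iota1 y & in_image iota1 w].
Proof.
have [xs xsE] := quintic_roots C.
have [i0 xi0] := quintic_root_index xsE q0.
have [i1 xi1] := quintic_root_index xsE q1.
have [i2 xi2] := quintic_nonreal_root xsE.
have [i3 xi3] : exists i3, xs i3 = (xs i2)^*.
  apply: (quintic_root_index xsE).
  by rewrite -(rmorph_quintic Num.conj) (quintic_root xsE) rmorph0.
have i01 : i0 != i1 by apply: contra_neq r01 => i01; rewrite -xi0 -xi1 i01.
have i23 : i2 != i3.
  by apply: contraNneq xi2 => i23; apply/CrealP; rewrite -xi3 i23.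
move: r0R r1R; rewrite -xi0 -xi1 => x0R x1R goodF k_gt0 wk.
exact: (root_closed_gt0 (isT : prime 5) (isT : odd 5) xsE
  (quintic_power_sum_int xsE) x0R x1R i01 i23 (esym xi3) k_gt0 goodF wk).
Qed.

(** A root [c] in [F] would split off ['X - c%:P], making [r0] a root of a linear or a quartic
    polynomial over [F]. This excludes every root of the quintic, so it does not matter which one a
    packing produces. *)
Lemma quintic_not_root (F : fieldType) (iota : {rmorphism F -> C}) b :
  keeps_degree 5 r0 iota -> in_image iota b -> quintic b != 0.
Proof.
move=> [_ free] [c cE]; apply/eqP => qb.
have qc : root (quintic 'X : {poly F}) c.
  rewrite /root horner_quintic -(fmorph_eq0 iota).
  by rewrite rmorph_quintic cE qb.
have /factor_theorem[g gE] := qc.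
have sg : (size g <= 5)%N.
  have := size_quintic F; rewrite gE size_Mmonic ?monicXsubC //.
    by rewrite size_XsubC addn2 => -[->].
  by apply/eqP => g0; have := size_quintic F; rewrite gE g0 mul0r size_poly0.
have : (map_poly iota (quintic 'X)).[r0] = 0 by rewrite map_poly_quintic horner_quintic.
rewrite gE rmorphM hornerM => /eqP; rewrite mulf_eq0 => /orP[]/eqP.
  move/(free _ sg) => g0; have := size_quintic F; by rewrite gE g0 mul0r size_poly0.
move/free; rewrite size_XsubC => /(_ isT) /eqP.
by rewrite polyXsubC_eq0.
Qed.

Lemma keeps_degree_rat : keeps_degree 5 r0 (ratr : {rmorphism rat -> C}).
Proof.
split=> [x [a <-]|g sg gr0].
  exists a; apply/esym/CrealP; exact: rpred_rat.
apply/eqP; apply/negPn/negP => g0.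
have rq : root (map_poly (ratr : {rmorphism rat -> C}) (quintic 'X)) r0.
  by rewrite /root map_poly_quintic horner_quintic q0.
have /subfx_irreducibleP : irreducible_poly (quintic 'X : {poly rat}).
  exact: quintic_irreducible.
move=> /(_ C ratr r0 rq).
rewrite -size_poly_gt0 size_quintic => /(_ isT g).
by rewrite /root gr0 eqxx => /(_ isT g0) /leq_trans/(_ sg).
Qed.

End NotRadical.

(** Induction on the run. The field grows only at root nodes, whichever root [w] is returned there;
    conjugation nodes use its stability. *)
Lemma rct_run_keeps_degree n (t : rct n) env out r0 r1 :
  r0 \is Num.real -> r1 \is Num.real -> r0 != r1 -> quintic r0 = 0 -> quintic r1 = 0 ->
  rct_run t env out ->
  forall (F : fieldType) (iota : {rmorphism F -> Cplx}), keeps_degree 5 r0 iota ->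
  (forall x, x \in env -> in_image iota x) ->
  exists (F1 : fieldType) (iota1 : {rmorphism F1 -> Cplx}), keeps_degree 5 r0 iota1 /\
    forall v, in_image iota1 (out v).1 /\ in_image iota1 (out v).2.
Proof.
move=> r0R r1R r01 q0 q1.
have env_rcons (F : fieldType) (iota : {rmorphism F -> Cplx}) (s : seq Cplx) y :
    in_image iota y -> (forall x, x \in s -> in_image iota x) ->
    forall x, x \in rcons s y -> in_image iota x.
  by move=> hy henv x; rewrite mem_rcons inE => /orP[/eqP ->|/henv].
elim=> {t env out}.
- move=> f env hf F iota free henv; exists F, iota; split=> // v.
  by have [h1 h2] := hf v; split; apply/henv/mem_nth.
- move=> z t env out _ IH F iota free henv.
  by apply: (IH F iota free); apply: env_rcons => //; apply: in_image_int.
- move=> i j t env out hi hj _ IH F iota free henv.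
  apply: (IH F iota free); apply: env_rcons => //.
  by apply: in_imageD; apply/henv/mem_nth.
- move=> i j t env out hi hj _ IH F iota free henv.
  apply: (IH F iota free); apply: env_rcons => //.
  by apply: in_imageB; apply/henv/mem_nth.
- move=> i j t env out hi hj _ IH F iota free henv.
  apply: (IH F iota free); apply: env_rcons => //.
  by apply: in_imageM; apply/henv/mem_nth.
- move=> i j t env out hi hj _ _ IH F iota free henv.
  apply: (IH F iota free); apply: env_rcons => //.
  by apply: in_image_div; apply/henv/mem_nth.
- move=> k i t env out w k_gt0 hi wk _ IH F iota free henv.
  have [|F1 [iota1 [free1 sub1 w1]]] :=
    keeps_degree_root r0R r1R r01 q0 q1 free k_gt0 (w := w).
    by rewrite wk; apply/henv/mem_nth.
  apply: (IH F1 iota1 free1); apply: env_rcons => // x /henv; exact: sub1.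
- move=> i t env out hi _ IH F iota free henv.
  apply: (IH F iota free); apply: env_rcons => //.
  by apply: free.1; apply/henv/mem_nth.
- by move=> i t1 t2 env out _ _ _.
- by move=> i t1 t2 env out _ _ _.
Qed.

(** * Two real roots of the quintic *)

Section RealRoots.
Local Open Scope complex_scope.
Variable R : rcfType.

Lemma quintic_real_root (a b : R) : a <= b -> quintic a * quintic b < 0 ->
  exists2 x, a < x < b & quintic x = 0.
Proof.
move=> ab qab; have [|x] := @poly_ivtoo _ (quintic 'X) a b ab.
  by rewrite !horner_quintic.
by rewrite in_itv /= => axb /rootP; rewrite horner_quintic => qx; exists x.
Qed.

Lemma quintic_complex_real_roots : exists r0 r1 : R[i],
  [/\ r0 \is Num.real, r1 \is Num.real, r0 != r1, quintic r0 = 0 & quintic r1 = 0].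
Proof.
(* The values at 0, 1, 3/2 are -2, 1, -25/32. *)
have [||x /andP[x0 x1] qx] := @quintic_real_root 0 1.
- by rewrite ler01.
- by rewrite /quintic; lra.
have [||y /andP[y0 y1] qy] := @quintic_real_root 1 (3%:R / 2%:R).
- by lra.
- have -> : quintic (3%:R / 2%:R) = - (25%:R / 32%:R) :> R by rewrite /quintic; field.
  by rewrite /quintic; lra.
have qC (z : R) : quintic z = 0 -> quintic (z%:C) = 0 :> R[i].
  by move=> qz; rewrite -(rmorph_quintic (real_complex R)) qz rmorph0.
exists (x%:C), (y%:C); split; try exact: qC.
- by apply/complex_realP; exists x.
- by apply/complex_realP; exists y.
by apply: contraTneq x1 => -[->]; rewrite -leNgt ltW.
Qed.
End RealRoots.

(** * Wheels in circle packings *)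

Section Wheel.
Variable R : realFieldType.
Implicit Types (d : nat -> nat -> R).

(** The relations among the 2 by 2 determinants of a family of plane vectors. *)
Definition plucker d : Prop :=
  (forall i j, d j i = - d i j) /\
  (forall i j l m, d i l * d j m = d i j * d l m + d i m * d j l).

Lemma same_sign (P Q : R) : 1 <= `|P| -> 1 <= `|Q| -> `|P - Q| = 1 -> 0 < P * Q.
Proof.
move=> hP hQ hPQ; rewrite ltNge; apply/negP => PQ.
have : `|P - Q| ^+ 2 = 1 by rewrite hPQ expr1n.
rewrite real_normK ?num_real //.
have : 1 <= `|P| ^+ 2 by rewrite exprn_ege1.
have : 1 <= `|Q| ^+ 2 by rewrite exprn_ege1.
by rewrite !real_normK ?num_real //; nra.
Qed.

(* For a rim edge [i, i+1] the sign of [d i j * d i.+1 j] tells on which side of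
   that edge [j] lies.  The Plucker relation for two disjoint rim edges writes 1
   as a difference of two numbers of absolute value at least 1, so these have
   the same sign and walking along the rim never changes sides. *)
Lemma wheel_normalized k d : plucker d ->
  (forall i j, (i < j < k)%N -> 1 <= `|d i j|) ->
  (forall i, (i.+1 < k)%N -> d i i.+1 = 1) -> `|d 0%N k.-1| = 1 -> (2 < k)%N ->
  0 < d 0%N 2 -> forall i j, (i < j < k)%N -> 0 < d i j.
Proof.
move=> [anti pl] d_ge1 d1 dk k_gt2 d02.
have ge1 i j : i != j -> (i < k)%N -> (j < k)%N -> 1 <= `|d i j|.
  move=> ij ik jk; have [ltij|ltji|/eqP] := ltngtP i j; last by rewrite (negPf ij).
    by apply: d_ge1; rewrite ltij.
  by rewrite anti normrN d_ge1 // ltji.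
have side i j l : (i.+1 < k)%N -> (j < k)%N -> (l < k)%N ->
    j != i -> j != i.+1 -> l != i -> l != i.+1 -> `|d j l| = 1 ->
    0 < (d i j * d i.+1 j) * (d i l * d i.+1 l).
  move=> ik jk lk ji ji1 li li1 djl; have ik' : (i < k)%N by apply: ltnW.
  have -> : d i j * d i.+1 j * (d i l * d i.+1 l) = (d i j * d i.+1 l) * (d i l * d i.+1 j) by ring.
  apply: same_sign; rewrite ?normrM ?mulr_ege1 ?ge1 // 1?eq_sym //.
  have := pl i i.+1 j l; rewrite d1 // mul1r => ->.
  by rewrite addrK djl.
have neq0 i j : i != j -> (i < k)%N -> (j < k)%N -> d i j != 0.
  move=> ij ik jk; have := ge1 i j ij ik jk; apply: contraTneq => ->.
  by rewrite normr0 -ltNge ltr01.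
have trans (a b c : R) : 0 < a * b -> 0 < b * c -> 0 < a * c by nra.
have up i n : (i.+2 + n < k)%N ->
    0 < d i i.+2 * (d i (i.+2 + n)%N * d i.+1 (i.+2 + n)%N).
  elim: n => [|n IHn] hn.
    rewrite addn0 [d i.+1 i.+2]d1 ?mulr1; last by lia.
    by rewrite -expr2 lt0r sqr_ge0 sqrf_eq0 neq0 //; lia.
  apply: (trans _ _ _ (IHn _)); first by lia.
  apply: side; try by lia.
  by rewrite addnS d1 ?normr1 //; lia.
have down i n : (i.+2 < k)%N -> (n <= i)%N ->
    0 < d i i.+2 * (d i.+1 (i - n)%N * d i.+2 (i - n)%N).
  move=> ik; elim: n => [|n IHn] hn.
    rewrite subn0 (anti i i.+1) (anti i i.+2) d1 ?mulNr ?mul1r ?opprK; last by lia.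
    by rewrite -expr2 lt0r sqr_ge0 sqrf_eq0 neq0 //; lia.
  apply: (trans _ _ _ (IHn _)); first by lia.
  apply: side; try by lia.
  have -> : (i - n = (i - n.+1).+1)%N by lia.
  by rewrite anti normrN d1 ?normr1 //; lia.
(* On the rim edge from [i.+1] to [i.+2], [down] leads to vertex 0 and [up] to vertex [k.-1]; these
   two are joined by the closing rim edge, so [side] links them. *)
have next i : (i.+3 < k)%N -> 0 < d i i.+2 * d i.+1 i.+3.
  move=> ik; have := down i i (ltnW ik) (leqnn i); rewrite subnn => h1.
  have := up i.+1 (k.-1 - i.+3)%N; rewrite (_ : i.+3 + _ = k.-1)%N; last by lia.
  have kk : (k.-1 < k)%N by lia.
  move=> /(_ kk); rewrite mulrC => h2.
  apply: (trans _ _ _ h1 (trans _ _ _ _ h2)).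
  apply: side; try by lia.
  by rewrite dk.
have d2 i : (i.+2 < k)%N -> 0 < d i i.+2.
  elim: i => // i IHi ik; have := next i ik; rewrite pmulr_rgt0 //.
  by apply: IHi; lia.
have pos n : forall i, (i.+1 + n < k)%N -> 0 < d i (i.+1 + n)%N.
  elim: n => [|n IHn] i ik; first by rewrite addn0 d1 ?ltr01 //; lia.
  have := up i n; rewrite addSn addnS => /(_ ltac:(lia)).
  rewrite pmulr_rgt0 ?d2 //; last by lia.
  rewrite pmulr_lgt0 ?addSn //.
  by have := IHn i.+1; rewrite !addSn; apply; lia.
by move=> i j /andP[ij jk]; rewrite -(subnKC ij) pos // subnKC.
Qed.

(** Signs are attached to the vertices so that [wheel_normalized] applies; all terms of the Plucker
    relation are then positive and equal their absolute values. *)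
Lemma wheel_ptolemy k d : plucker d ->
  (forall i j, (i < j < k)%N -> 1 <= `|d i j|) ->
  (forall i, (i.+1 < k)%N -> `|d i i.+1| = 1) -> `|d 0%N k.-1| = 1 ->
  forall i j l m, (i < j)%N -> (j < l)%N -> (l < m)%N -> (m < k)%N ->
  `|d i l| * `|d j m| = `|d i j| * `|d l m| + `|d i m| * `|d j l|.
Proof.
move=> [anti pl] d_ge1 d1 dk i j l m ij jl lm mk.
have k_gt2 : (2 < k)%N by lia.
pose e := fix e n := if n is n'.+1 then (if 0 <= d n' n'.+1 then e n' else - e n') else 1 : R.
have e_norm n : `|e n| = 1.
  by elim: n => [|n IHn] /=; rewrite ?normr1 //; case: ifP; rewrite ?normrN.
have e_sq n : e n * e n = 1 by rewrite -expr2 -(real_normK (num_real _)) e_norm expr1n.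
pose c := Num.sg (e 2 * d 0%N 2).
have d02 : d 0%N 2 != 0.
  have := d_ge1 0%N 2 k_gt2; apply: contraTneq => ->.
  by rewrite normr0 -ltNge ltr01.
have e2 : e 2 != 0 by rewrite -normr_gt0 e_norm ltr01.
have c_norm : `|c| = 1 by rewrite normr_sg mulf_neq0.
have c_sq : c * c = 1 by rewrite -expr2 -(real_normK (num_real _)) c_norm expr1n.
(* The signs [e] make consecutive determinants 1. If this leaves the one for 0 and 2 negative,
   alternating signs together with the global factor [c] flip it and keep the consecutive ones. *)
pose f n := if 0 < c then e n else if odd n then - e n else e n.
pose D i j := c * (f i * f j * d i j).
have f_norm n : `|f n| = 1.
  by rewrite /f; case: ifP => _; rewrite ?e_norm //; case: ifP => _; rewrite ?normrN e_norm.
have D_norm n n' : `|D n n'| = `|d n n'|.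
  by rewrite /D !normrM c_norm !f_norm !mul1r.
have D_plucker : plucker D.
  split=> [n n'|n1 n2 n3 n4]; first by rewrite /D anti; ring.
  transitivity (c * c * f n1 * f n2 * f n3 * f n4 * (d n1 n3 * d n2 n4)).
    by rewrite /D; ring.
  by rewrite pl /D; ring.
have D1 n : (n.+1 < k)%N -> D n n.+1 = 1.
  move=> nk; have cs : c = 1 \/ c = -1.
    by move/eqP: c_sq; rewrite -expr2 sqrf_eq1 => /orP[]/eqP; [left | right].
  have ed : e n * e n.+1 * d n n.+1 = 1.
    rewrite /=; case: ifP => h; rewrite ?mulrN ?mulNr e_sq mul1r.
      by rewrite -(ger0_norm h) d1.
    by rewrite -[LHS]ltr0_norm ?d1 // ltNge h.
  rewrite /D /f [odd n.+1]/=; move: (e n) (e n.+1) ed => a b ed.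
  case: cs => ->; rewrite ?ltr01 ?mul1r // ltr0N1.
  by case: (odd n) => /=; rewrite -[RHS]ed; ring.
have D02 : 0 < D 0%N 2.
  have -> : D 0%N 2 = c * (e 2 * d 0%N 2).
    by rewrite /D /f /=; case: ifP; rewrite mul1r.
  by rewrite /c -normrEsg normr_gt0 mulf_neq0.
have pos i' j' : (i' < j' < k)%N -> `|d i' j'| = D i' j'.
  move=> h; rewrite -D_norm gtr0_norm //; move: h.
  apply: (wheel_normalized D_plucker) => // [n n' h|].
    by rewrite D_norm; exact: d_ge1.
  by rewrite D_norm.
rewrite !pos; try lia.
exact: D_plucker.2.
Qed.


End Wheel.

(** * Circles tangent to a common hub *)

Section CirclePacking.
Variables (R : rcfType) (V : eqType) (x y r : V -> R).
Hypothesis r_gt0 : forall v, 0 < r v.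

Definition lambda2 (u v : V) : R :=
  ((x u - x v) ^+ 2 + (y u - y v) ^+ 2 - (r u - r v) ^+ 2) / (4%:R * r u * r v).

Definition lambda (u v : V) : R := Num.sqrt (lambda2 u v).

Lemma lambda_sym u v : lambda u v = lambda v u.
Proof. by rewrite /lambda /lambda2 mulrAC; congr (Num.sqrt (_ / _)); ring. Qed.

Lemma lambda_ge1 u v : 1 <= lambda2 u v -> 1 <= lambda u v.
Proof. by move=> h; rewrite -sqrtr1; apply: ler_wsqrtr. Qed.

Lemma lambda2_eq1 u v :
  lambda2 u v = 1 <-> (x u - x v) ^+ 2 + (y u - y v) ^+ 2 = (r u + r v) ^+ 2.
Proof.
have D0 : 4%:R * r u * r v != 0 by rewrite !mulf_neq0 ?pnatr_eq0 ?gt_eqF.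
rewrite /lambda2; split=> [/(canRL (mulfVK D0))|->]; last first.
  by apply: (mulIf D0); rewrite mulfVK //; ring.
by rewrite mul1r => /(canRL (subrK _)) ->; ring.
Qed.

Lemma lambda2_ge1 u v :
  1 <= lambda2 u v <-> (r u + r v) ^+ 2 <= (x u - x v) ^+ 2 + (y u - y v) ^+ 2.
Proof.
have D0 : 0 < 4%:R * r u * r v by rewrite !mulr_gt0.
rewrite /lambda2 ler_pdivlMr // mul1r lerBrDr.
by rewrite (_ : _ * r v + _ = (r u + r v) ^+ 2) //; ring.
Qed.

Lemma sqrtc_ReIm (a b : R) (w := sqrtc (Complex a b)) :
  complex.Re w ^+ 2 - complex.Im w ^+ 2 = a /\ 2%:R * complex.Re w * complex.Im w = b.
Proof.
have := sqr_sqrtc (Complex a b); rewrite -/w; case: w => s t /eqP.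
rewrite expr2 eq_complex /= => /andP[/eqP ha /eqP hb].
by rewrite -ha -hb; split; ring.
Qed.

(** Write the centre of rim circle n relative to the hub, divided by its radius, as (s + it)^2.
    Tangency to the hub fixes s^2 + t^2, and then the determinants of the vectors (s, t) are the
    [lambda] up to sign. *)
Lemma packing_wheel (h : V) (p : nat -> V) (k : nat) : (3 < k)%N ->
  (forall i j, (i < j < k)%N -> 1 <= lambda2 (p i) (p j)) ->
  (forall i, (i < k)%N -> lambda2 h (p i) = 1) ->
  (forall i, (i.+1 < k)%N -> lambda2 (p i) (p i.+1) = 1) ->
  lambda2 (p 0%N) (p k.-1) = 1 ->
  forall i j l m, (i < j)%N -> (j < l)%N -> (l < m)%N -> (m < k)%N ->
  lambda (p i) (p l) * lambda (p j) (p m) =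
  lambda (p i) (p j) * lambda (p l) (p m) + lambda (p i) (p m) * lambda (p j) (p l).
Proof.
move=> k_gt3 ge1 hub rim rim0.
pose w n := sqrtc (Complex ((x (p n) - x h) / r (p n)) ((y (p n) - y h) / r (p n))).
pose s n := complex.Re (w n); pose t n := complex.Im (w n).
have st n : s n ^+ 2 - t n ^+ 2 = (x (p n) - x h) / r (p n) /\
    2%:R * s n * t n = (y (p n) - y h) / r (p n) by exact: sqrtc_ReIm.
pose d i j := s i * t j - t i * s j.
have d_plucker : plucker d by split=> *; rewrite /d; ring.
have norm_st n : (n < k)%N -> s n ^+ 2 + t n ^+ 2 = (r h + r (p n)) / r (p n).
  move=> nk; have [ha hb] := st n; have rn := r_gt0 (p n); have rh := r_gt0 h.
  have e : (s n ^+ 2 + t n ^+ 2) ^+ 2 = ((r h + r (p n)) / r (p n)) ^+ 2.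
    transitivity ((s n ^+ 2 - t n ^+ 2) ^+ 2 + (2%:R * s n * t n) ^+ 2); first by ring.
    rewrite ha hb !expr_div_n -mulrDl; congr (_ / _).
    have : (x h - x (p n)) ^+ 2 + (y h - y (p n)) ^+ 2 = (r h + r (p n)) ^+ 2.
      by have := hub n nk; move/lambda2_eq1.
    by move=> <-; ring.
  apply/eqP; rewrite -(@eqrXn2 _ 2) ?addr_ge0 ?sqr_ge0 ?divr_ge0 ?addr_ge0 ?ltW //.
  by rewrite e.
have d_sq i j : (i < k)%N -> (j < k)%N -> d i j ^+ 2 = lambda2 (p i) (p j).
  move=> ik jk; have [ai bi] := st i; have [aj bj] := st j.
  have -> : d i j ^+ 2 = ((s i ^+ 2 + t i ^+ 2) * (s j ^+ 2 + t j ^+ 2)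
     - ((s i ^+ 2 - t i ^+ 2) * (s j ^+ 2 - t j ^+ 2)
        + (2%:R * s i * t i) * (2%:R * s j * t j))) / 2%:R.
    by rewrite /d; field.
  rewrite !norm_st // ai aj bi bj /lambda2.
  have hi : (x h - x (p i)) ^+ 2 + (y h - y (p i)) ^+ 2 = (r h + r (p i)) ^+ 2.
    exact/lambda2_eq1/hub.
  have hj : (x h - x (p j)) ^+ 2 + (y h - y (p j)) ^+ 2 = (r h + r (p j)) ^+ 2.
    exact/lambda2_eq1/hub.
  have -> : (x (p i) - x (p j)) ^+ 2 + (y (p i) - y (p j)) ^+ 2 =
      (r h + r (p i)) ^+ 2 + (r h + r (p j)) ^+ 2
      - 2%:R * ((x (p i) - x h) * (x (p j) - x h) + (y (p i) - y h) * (y (p j) - y h)).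
    by rewrite -hi -hj; ring.
  by field; rewrite !gt_eqF.
have d_norm i j : (i < k)%N -> (j < k)%N -> `|d i j| = lambda (p i) (p j).
  by move=> ik jk; rewrite /lambda -d_sq // sqrtr_sqr.
move=> i j l m ij jl lm mk; rewrite -!d_norm; try lia.
apply: (@wheel_ptolemy _ k) => // {i j l m ij jl lm mk} [i j /andP[ij jk]|i ik|].
- rewrite d_norm ?lambda_ge1 ?ge1 ?ij //; lia.
- by rewrite d_norm; try lia; rewrite /lambda rim // sqrtr1.
- by rewrite d_norm; try lia; rewrite /lambda rim0 sqrtr1.
Qed.

End CirclePacking.

(** * The graph and its packings *)

(* Vertices 0 to 6 form the rim of a wheel with hub 7; the adjacent vertices 8
   and 9 share the other side of the rim.  Vertices 10 to 15 are isolated. *)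
Definition packing_edges : seq (nat * nat) :=
  [seq (i, i.+1) | i <- iota 0 6] ++ (0, 6)%N :: [seq (7, i)%N | i <- iota 0 7] ++
  [:: (8, 0); (8, 1); (8, 2); (8, 9)]%N ++
  [:: (9, 2); (9, 3); (9, 4); (9, 5); (9, 6); (9, 0)]%N.

Definition packing_graph (u v : nat) : bool :=
  ((u, v) \in packing_edges) || ((v, u) \in packing_edges).

(** * Elimination in the wheels of the graph *)

Section Rigidity.
Variables (R : rcfType) (x y r : nat -> R).
Hypothesis r_gt0 : forall v, 0 < r v.
Hypothesis disjoint : forall u v, (u < 10)%N -> (v < 10)%N -> u != v ->
  1 <= lambda2 x y r u v.
Hypothesis tangent : forall u v, packing_graph u v -> lambda2 x y r u v = 1.

Notation lam := (lambda x y r).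

Definition is_wheel (h : nat) (s : seq nat) : bool :=
  [&& (3 < size s)%N, uniq s, all (fun v => v < 10)%N s, all (packing_graph h) s,
      all (fun i => packing_graph (nth 0%N s i) (nth 0%N s i.+1)) (iota 0 (size s).-1)
    & packing_graph (nth 0%N s 0) (nth 0%N s (size s).-1)].

Lemma ptolemy h s : is_wheel h s -> forall i j l m,
  (i < j)%N -> (j < l)%N -> (l < m)%N -> (m < size s)%N ->
  let p := nth 0%N s in
  lam (p i) (p l) * lam (p j) (p m) =
  lam (p i) (p j) * lam (p l) (p m) + lam (p i) (p m) * lam (p j) (p l).
Proof.
case/and5P=> s_gt3 s_uniq s10 hub /andP[rim rim0] i j l m ij jl lm ms /=.
apply: (packing_wheel r_gt0 s_gt3 (h := h)) => // {i j l m ij jl lm ms}.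
- move=> i j /andP[ij js]; have is_ := ltn_trans ij js.
  apply: disjoint; try exact: (allP s10 _ (mem_nth _ _)).
  by rewrite nth_uniq // ltn_eqF.
- by move=> i is_; apply/tangent/(allP hub)/mem_nth.
- move=> i is_; apply: tangent; apply: (allP rim); rewrite mem_iota; lia.
- exact: tangent.
Qed.

Lemma lam_edge u v : packing_graph u v -> lam u v = 1.
Proof. by move/tangent; rewrite /lambda => ->; rewrite sqrtr1. Qed.

(** The four-wheels at 3, 4, 5, 6 make four chords of the seven-wheel equal to [b = 2 / beta], and
    the one at 1 gives [alpha * a = 2]. The wheel at 7 expresses [g], [f], [a] in [b], and the wheel
    at 0 gives [c] in terms of [a] and [b]. *)
Lemma packing_quintic : quintic (lam 3%N 5%N) = 0.
Proof.
have q1 := @ptolemy 1 [:: 7; 0; 8; 2]%N isT 0 1 2 3 isT isT isT isT.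
have q3 := @ptolemy 3 [:: 7; 2; 9; 4]%N isT 0 1 2 3 isT isT isT isT.
have q4 := @ptolemy 4 [:: 7; 3; 9; 5]%N isT 0 1 2 3 isT isT isT isT.
have q5 := @ptolemy 5 [:: 7; 4; 9; 6]%N isT 0 1 2 3 isT isT isT isT.
have q6 := @ptolemy 6 [:: 7; 0; 9; 5]%N isT 0 1 2 3 isT isT isT isT.
have p1 := @ptolemy 0 [:: 7; 1; 8; 9; 6]%N isT 0 1 2 3 isT isT isT isT.
have p2 := @ptolemy 0 [:: 7; 1; 8; 9; 6]%N isT 0 1 3 4 isT isT isT isT.
have h1 := @ptolemy 7 (iota 0 7) isT 2 3 4 5 isT isT isT isT.
have h2 := @ptolemy 7 (iota 0 7) isT 2 4 5 6 isT isT isT isT.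
have h3 := @ptolemy 7 (iota 0 7) isT 0 2 5 6 isT isT isT isT.
have h4 := @ptolemy 7 (iota 0 7) isT 0 1 2 6 isT isT isT isT.
move: q1 q3 q4 q5 q6 p1 p2 h1 h2 h3 h4 => /=.
have e := lam_edge; rewrite !(e 7 0, e 7 1, e 7 2, e 7 3, e 7 4, e 7 5, e 7 6)%N //.
rewrite !(e 8 2, e 0 8, e 9 4, e 2 9, e 9 5, e 3 9, e 9 6, e 4 9, e 0 9)%N //.
rewrite !(e 8 9, e 1 8, e 2 3, e 3 4, e 4 5, e 5 6, e 0 6, e 0 1, e 1 2)%N //.
rewrite ?mul1r ?mulr1 ?(lambda_sym _ _ _ 5 0)%N.
have b_ge1 : 1 <= lam 3%N 5%N by apply/lambda_ge1/disjoint.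
have beta_ge1 : 1 <= lam 7%N 9%N by apply/lambda_ge1/disjoint.
move: (lam 7 8) (lam 0 2) (lam 7 9) (lam 2 4) (lam 3 5) (lam 4 6) (lam 0 5)
  (lam 1 9) (lam 1 6) (lam 2 5) (lam 2 6) beta_ge1 b_ge1 => /=
  alpha a beta b24 b b46 b05 e19 c g f beta_ge1 b_ge1 E1 E2 E3 E4 E5 E6 E7 E8 E9 E10 E11.
have beta0 : beta != 0 by rewrite gt_eqF // (lt_le_trans ltr01).
have eb t : beta * t = 1 + 1 -> t = b by rewrite -E3 => /(mulfI beta0).
rewrite (eb _ E2) in E8 E9; rewrite (eb _ E4) in E9; rewrite (eb _ E5) in E10.
have gE : g = b ^+ 2 - 1 by rewrite expr2 E8; ring.
have fE : f = b ^+ 3 - 2%:R * b.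
  by transitivity (g * b - b); [rewrite E9; ring | rewrite gE; ring].
have aE : a = b ^+ 4 - 3%:R * b ^+ 2 + 1.
  by transitivity (b * f - g); [rewrite E10; ring | rewrite fE gE; ring].
have cE : 4%:R * c = 2%:R * b + 2%:R * a + a * b.
  transitivity (alpha * a * (beta * b) * c); first by rewrite E1 E3; ring.
  transitivity (alpha * a * b * (beta * c)); first by ring.
  rewrite E7; transitivity (a * b * (alpha + alpha * e19)); first by ring.
  rewrite E6; transitivity (alpha * a * b + a * b + a * (beta * b)); first by ring.
  by rewrite E1 E3; ring.
(* Four times the remaining relation [E11]; the extraneous factor is nonzero because [b] is at least
   1. *)
have : (b ^+ 2 + b - 1) ^+ 2 * quintic b = 0.
  transitivity (a * (4%:R * c) - 4%:R * (f + 1)).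
    by rewrite cE aE fE /quintic; ring.
  by rewrite -E11; ring.
move/eqP; rewrite mulf_eq0 expf_eq0 /= => /orP[/eqP h|/eqP //].
by exfalso; nra.
Qed.
End Rigidity.

(** * Existence of a packing *)

Section Existence.
Variables (R : rcfType) (b : R).
Hypotheses (b_lo : 113 / 64 < b) (b_hi : b < 83 / 47) (qb : quintic b = 0).

(* A disc of centre [c] and radius [r] has inversive coordinates
   [1 / r], [c / r] and [(|c|^2 - r^2) / r], in which the inversive product is
   bilinear: [gram u v] is 2 for tangent and at least 2 for disjoint discs.
   With hub 7 the unit disc, rim disc [j] has [c / r = (X + iY)^2] and
   [1 / r = X^2 + Y^2 - 1], where [(X, Y) = (alpha sqrt(3/4), beta sqrt(1/3))]
   and [(alpha, beta)] is (1, -1) for 4, (1, 1) for 5, and continues along the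
   rim by p_(i+1) = b p_i - p_(i-1).  Discs 8 and 9 are the linear combinations
   of three consecutive rim discs and the hub fixed by their tangencies;
   everything is reduced modulo the quintic. *)
Definition bend (v : nat) : R := nth 1 [::
  (1 + 10 * b - 13 * b ^+ 2 - 10 * b ^+ 3 + 13 * b ^+ 4) / 12;
  (1 - 4 * b - 2 * b ^+ 2 + 4 * b ^+ 3 + 2 * b ^+ 4) / 3;
  (1 + 10 * b - 13 * b ^+ 2 - 10 * b ^+ 3 + 13 * b ^+ 4) / 12;
  (1 - 10 * b + 13 * b ^+ 2) / 12;
  1 / 12;
  1 / 12;
  (1 - 10 * b + 13 * b ^+ 2) / 12;
  1;
  (4 - 8 * b - 9 * b ^+ 2 + 8 * b ^+ 3 + 5 * b ^+ 4) / 6;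
  (10 - 5 * b - 5 * b ^+ 2 + b ^+ 3 + b ^+ 4) / 3] v.

(** The default values here and in the other coordinates give the isolated vertices unit discs on
    the real axis, 3 apart and away from the first ten. *)
Definition bend_x (v : nat) : R := nth (20 + 3 * v)%:R [::
  (5 + 26 * b - 5 * b ^+ 2 - 26 * b ^+ 3 + 5 * b ^+ 4) / 12;
  (- 4 + 4 * b + 2 * b ^+ 2 - 4 * b ^+ 3 - 2 * b ^+ 4) / 3;
  (5 + 26 * b - 5 * b ^+ 2 - 26 * b ^+ 3 + 5 * b ^+ 4) / 12;
  (5 - 26 * b + 5 * b ^+ 2) / 12;
  5 / 12;
  5 / 12;
  (5 - 26 * b + 5 * b ^+ 2) / 12;
  0;
  (14 + 8 * b - 21 * b ^+ 2 - 8 * b ^+ 3 + b ^+ 4) / 6;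
  (77 - 25 * b - 55 * b ^+ 2 + 5 * b ^+ 3 + 11 * b ^+ 4) / 3] v.

Definition bend_y (v : nat) : R := nth 0 [::
  1 - 3 * b ^+ 2 + b ^+ 4;
  0;
  - 1 + 3 * b ^+ 2 - b ^+ 4;
  1 - b ^+ 2;
  - 1;
  1;
  - 1 + b ^+ 2;
  0;
  0;
  0] v.

Definition cobend (v : nat) : R := nth ((20 + 3 * v)%:R ^+ 2 - 1) [::
  (25 + 10 * b - 13 * b ^+ 2 - 10 * b ^+ 3 + 13 * b ^+ 4) / 12;
  (7 - 4 * b - 2 * b ^+ 2 + 4 * b ^+ 3 + 2 * b ^+ 4) / 3;
  (25 + 10 * b - 13 * b ^+ 2 - 10 * b ^+ 3 + 13 * b ^+ 4) / 12;
  (25 - 10 * b + 13 * b ^+ 2) / 12;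
  25 / 12;
  25 / 12;
  (25 - 10 * b + 13 * b ^+ 2) / 12;
  - 1;
  (184 - 8 * b - 129 * b ^+ 2 + 8 * b ^+ 3 + 29 * b ^+ 4) / 6;
  (592 - 125 * b - 425 * b ^+ 2 + 25 * b ^+ 3 + 85 * b ^+ 4) / 3] v.


Definition gram (u v : nat) : R :=
  bend u * cobend v + bend v * cobend u
  - 2 * (bend_x u * bend_x v + bend_y u * bend_y v).

(** Enclosures tight enough for the later inequalities to follow linearly, with the powers of [b] as
    independent variables. *)
Lemma b_bounds : [/\ 293 / 94 < b ^+ 2 < 184 / 59, 655 / 119 < b ^+ 3 < 336 / 61 &
  379 / 39 < b ^+ 4 < 107 / 11].
Proof.
have b0 : 0 < b by move: b_lo; lra.
have [l2 u2] : 293 / 94 < b ^+ 2 /\ b ^+ 2 < 184 / 59.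
  by move: b_lo b_hi => lo hi; split; nra.
have [l3 u3] : 655 / 119 < b ^+ 3 /\ b ^+ 3 < 336 / 61.
  by rewrite exprS; move: b_lo b_hi => lo hi; split; nra.
have [l4 u4] : 379 / 39 < b ^+ 4 /\ b ^+ 4 < 107 / 11.
  by rewrite exprS; move: b_lo b_hi => lo hi; split; nra.
by split; apply/andP.
Qed.

Lemma b_powers : [/\ b ^+ 5 = 5 * b ^+ 3 - 7 * b + 2,
  b ^+ 6 = 5 * b ^+ 4 - 7 * b ^+ 2 + 2 * b,
  b ^+ 7 = 18 * b ^+ 3 + 2 * b ^+ 2 - 35 * b + 10 &
  b ^+ 8 = 18 * b ^+ 4 + 2 * b ^+ 3 - 35 * b ^+ 2 + 10 * b].
Proof.
have b5 : b ^+ 5 = 5 * b ^+ 3 - 7 * b + 2.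
  by apply/eqP; rewrite -subr_eq0 -qb /quintic; apply/eqP; ring.
have b6 : b ^+ 6 = 5 * b ^+ 4 - 7 * b ^+ 2 + 2 * b by rewrite exprS b5; ring.
have b7 : b ^+ 7 = 18 * b ^+ 3 + 2 * b ^+ 2 - 35 * b + 10.
  by rewrite exprS b6 mulrDr mulrBr mulrCA -exprS b5; ring.
by split=> //; rewrite exprS b7; ring.
Qed.

Lemma bend_gt0 v : 0 < bend v.
Proof.
have [/andP[? ?] /andP[? ?] /andP[? ?]] := b_bounds; move: b_lo b_hi => ? ?.
do 10 (destruct v as [|v]; first by rewrite /bend /=; lra).
by rewrite /bend nth_default // ltr01.
Qed.

(** With centre c and radius r both sides are |c|^2 / r^2: this ties the redundant coordinate
    [cobend] to the other three. *)
Lemma gram_self v : (v < 16)%N ->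
  bend_x v ^+ 2 + bend_y v ^+ 2 = bend v * cobend v + 1.
Proof.
have [? ? ? ?] := b_powers.
do 16 (destruct v as [|v]; first by rewrite /bend /bend_x /bend_y /cobend /=; lra).
by [].
Qed.

Lemma gram_sym u v : gram u v = gram v u.
Proof. by rewrite /gram; ring. Qed.

Lemma gram_edge u v : packing_graph u v -> gram u v = 2.
Proof.
have h : all (fun e => gram e.1 e.2 == 2) packing_edges.
  have [? ? ? ?] := b_powers.
  rewrite /= /gram /bend /bend_x /bend_y /cobend /=.
  by repeat (apply/andP; split) => //; apply/eqP; lra.
case/orP=> /(allP h)/eqP //=; by rewrite gram_sym.
Qed.

Lemma gram_ge2 u v : (u < 16)%N -> (v < 16)%N -> u != v -> 2 <= gram u v.
Proof.
wlog uv : u v / (u < v)%N => [H u16 v16 neq_uv|u16 v16 _].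
  have [ltuv|ltvu|euv] := ltngtP u v; first exact: H.
    by rewrite gram_sym H // eq_sym.
  by rewrite euv eqxx in neq_uv.
have h : all (fun v => all (fun u => 2 <= gram u v) (iota 0 v)) (iota 0 16).
  have [? ? ? ?] := b_powers.
  have [/andP[? ?] /andP[? ?] /andP[? ?]] := b_bounds; move: b_lo b_hi => ? ?.
  rewrite /= /gram /bend /bend_x /bend_y /cobend /=.
  by repeat (apply/andP; split) => //; lra.
have /(allP h)/allP : v \in iota 0 16 by rewrite mem_iota.
by apply; rewrite mem_iota.
Qed.

End Existence.

(** * Disjoint and tangent discs in the complex plane *)

Section Discs.
Variable C : numClosedFieldType.
Implicit Types (c z : C) (r : C).

Lemma disjoint_discs c1 c2 r1 r2 : 0 < r1 -> 0 < r2 ->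
  ~ (exists z : C, `|z - c1| < r1 /\ `|z - c2| < r2) <-> r1 + r2 <= `|c1 - c2|.
Proof.
move=> r1_gt0 r2_gt0; have r12 : 0 < r1 + r2 by rewrite addr_gt0.
split=> [disj|r12_le [z [z1 z2]]]; last first.
  rewrite distrC in z1; have := le_lt_trans (ler_distD z c1 c2) (ltrD z1 z2).
  by move/(le_lt_trans r12_le); rewrite ltxx.
rewrite real_leNgt ?ger0_real ?normr_ge0 ?ltW //; apply/negP => lt12.
(* The point dividing the segment from [c1] to [c2] in the ratio [r1 : r2]. *)
apply: disj; exists ((r2 * c1 + r1 * c2) / (r1 + r2)).
have e1 : (r2 * c1 + r1 * c2) / (r1 + r2) - c1 = r1 / (r1 + r2) * (c2 - c1).
  by field; rewrite gt_eqF.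
have e2 : (r2 * c1 + r1 * c2) / (r1 + r2) - c2 = r2 / (r1 + r2) * (c1 - c2).
  by field; rewrite gt_eqF.
rewrite e1 e2 !(normrM, normfV) [`|c2 - c1|]distrC.
rewrite !(gtr0_norm r1_gt0, gtr0_norm r2_gt0, gtr0_norm r12).
by split; rewrite -mulrA gtr_pMr // mulrC ltr_pdivrMr // mul1r.
Qed.

(** Uniqueness is the equality case of the triangle inequality: [c1 - z] and [z - c2] are multiples
    of one unit vector [t]. *)
Lemma tangent_circles c1 c2 r1 r2 : 0 < r1 -> 0 < r2 -> `|c1 - c2| = r1 + r2 ->
  exists! z : C, `|z - c1| = r1 /\ `|z - c2| = r2.
Proof.
move=> r1_gt0 r2_gt0 d12; have r12 : 0 < r1 + r2 by rewrite addr_gt0.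
exists ((r2 * c1 + r1 * c2) / (r1 + r2)); split=> [|z [z1 z2]].
  have e1 : (r2 * c1 + r1 * c2) / (r1 + r2) - c1 = r1 / (r1 + r2) * (c2 - c1).
    by field; rewrite gt_eqF.
  have e2 : (r2 * c1 + r1 * c2) / (r1 + r2) - c2 = r2 / (r1 + r2) * (c1 - c2).
    by field; rewrite gt_eqF.
  rewrite e1 e2 !(normrM, normfV) [`|c2 - c1|]distrC d12.
  rewrite !(gtr0_norm r1_gt0, gtr0_norm r2_gt0, gtr0_norm r12).
  by rewrite !divfK ?gt_eqF.
have := @normCDeq C (c1 - z) (z - c2).
rewrite addrA subrK d12 [`|c1 - z|]distrC z1 z2 => /(_ erefl)[t _ [h1 h2]].
have -> : c1 = z + r1 * t by rewrite -h1 addrC subrK.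
have -> : c2 = z - r2 * t by rewrite -h2 opprB addrC subrK.
by field; rewrite gt_eqF.
Qed.

Lemma tangent_dist c1 c2 r1 r2 : r1 + r2 <= `|c1 - c2| ->
  (exists! z : C, `|z - c1| = r1 /\ `|z - c2| = r2) -> `|c1 - c2| = r1 + r2.
Proof.
move=> le12 [z [[z1 z2] _]]; apply/eqP; rewrite eq_le le12 andbT.
by have := ler_distD z c1 c2; rewrite [`|c1 - z|]distrC z1 z2.
Qed.

End Discs.

Section RealCobend_ys.
Variable R : rcfType.
Local Open Scope complex_scope.

Lemma normc_sqr (a b s : R) : 0 <= s ->
  ((s%:C <= `|a +i* b|) = (s ^+ 2 <= a ^+ 2 + b ^+ 2)) *
  ((`|a +i* b| == s%:C) = (a ^+ 2 + b ^+ 2 == s ^+ 2)).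
Proof.
move=> s0; have ab0 : 0 <= a ^+ 2 + b ^+ 2 by rewrite addr_ge0 ?sqr_ge0.
rewrite normc_def /= lecR (inj_eq (@complexI R)); split.
  by rewrite -(@ler_pXn2r _ 2) ?nnegrE ?sqrtr_ge0 // sqr_sqrtr.
by rewrite -(eqrXn2 (n := 2)) ?sqrtr_ge0 // sqr_sqrtr.
Qed.

End RealCobend_ys.

Local Open Scope complex_scope.

Definition graph16 : rel 'I_16 := fun u v => packing_graph u v.

Lemma graph16_sym : symmetric graph16.
Proof. by move=> u v; rewrite /graph16 /packing_graph orbC. Qed.

Lemma graph16_irr : irreflexive graph16.
Proof.
move=> u; apply/negbTE/negP; rewrite /graph16 /packing_graph orbb.
have h : all (fun e => e.1 != e.2) packing_edges by [].
by move/(allP h); rewrite eqxx.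
Qed.

(** * Real coordinates of a complex packing *)

Section Cobend_ysOfPacking.
Variable R : rcfType.
Variables (c r : 'I_16 -> R[i]).
Hypothesis r_gt0 : forall v, 0 < r v.
Hypothesis disj : forall u v, u != v -> r u + r v <= `|c u - c v|.
Hypothesis tang : forall u v, graph16 u v -> `|c u - c v| = r u + r v.

Let x (v : nat) : R := complex.Re (c (inord v)).
Let y (v : nat) : R := complex.Im (c (inord v)).
Let rho (v : nat) : R := complex.Re (r (inord v)).

Let rE v : r (inord v) = (rho v)%:C.
Proof.
have := r_gt0 (inord v); rewrite /rho; case: (r _) => p q.
by rewrite ltcE /= => /andP[/eqP -> _].
Qed.

Let rho_gt0 v : 0 < rho v. Proof. by rewrite -ltcR -rE. Qed.

Let cE u v : c (inord u) - c (inord v) = (x u - x v) +i* (y u - y v).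
Proof. by rewrite /x /y; case: (c (inord u)) (c (inord v)) => ? ? []. Qed.

Let rr u v : 0 <= rho u + rho v. Proof. by rewrite addr_ge0 ?ltW. Qed.

Let disj2 u v : (u < 16)%N -> (v < 16)%N -> u != v -> 1 <= lambda2 x y rho u v.
Proof.
move=> u16 v16 uv; apply/lambda2_ge1 => //.
have := disj (u := inord u) (v := inord v); rewrite cE !rE -rmorphD normc_sqr //.
by apply; apply: contra_neq uv => /(congr1 val); rewrite /= !inordK.
Qed.

Lemma packing_root : quintic (lambda x y rho 3%N 5%N) = 0.
Proof.
apply: packing_quintic => //.
  by move=> u v u10 v10; apply: disj2; [apply: leq_trans u10 _ | apply: leq_trans v10 _].
move=> u v uv; apply/lambda2_eq1 => //; apply/eqP.
rewrite -(normc_sqr _ _ (rr u v)).2 rmorphD /= -!rE -cE; apply/eqP/tang.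
have h : all (fun e => (e.1 < 16)%N && (e.2 < 16)%N) packing_edges by [].
have /andP[u16 v16] : (u < 16)%N && (v < 16)%N.
  by case/orP: (uv) => /(allP h) //= ; rewrite andbC.
by rewrite /graph16 !inordK.
Qed.

(** The square is rational in the centres, their conjugates and the radii; [lambda] itself costs one
    more square root. *)
Lemma lambda_sqr_in_image (F : fieldType) (iota : {rmorphism F -> R[i]}) :
  (forall z, in_image iota z -> in_image iota (z^*)%R) ->
  (forall v, in_image iota (c v) /\ in_image iota (r v)) ->
  in_image iota ((lambda x y rho 3%N 5%N)%:C ^+ 2).
Proof.
move=> conjF outF; set u := inord 3 : 'I_16; set v := inord 5 : 'I_16.
have -> : (lambda x y rho 3%N 5%N)%:C ^+ 2 =
    ((c u - c v) * ((c u - c v)^*)%R - (r u - r v) ^+ 2) / (4%:R * r u * r v).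
  rewrite -normCK cE !rE normc_def /= -!rmorphXn sqr_sqrtr ?sqr_sqrtr //=.
  - by rewrite /lambda2 fmorph_div !(rmorphB, rmorphXn, rmorphM, rmorph_nat).
  - by rewrite addr_ge0 ?sqr_ge0.
  - by rewrite (le_trans ler01) // disj2.
have [cu ru] := outF u; have [cv rv] := outF v.
apply: in_image_div.
  apply: in_imageB; last exact/in_imageX/in_imageB.
  by apply: in_imageM; [|apply: conjF]; apply: in_imageB.
by apply/in_imageM => //; apply/in_imageM => //; apply: in_image_nat.
Qed.
End Cobend_ysOfPacking.

Section ExistenceOfPacking.
Variable R : rcfType.

Lemma packing_exists : exists c r : 'I_16 -> R[i], [/\ forall v, 0 < r v,
  forall u v, u != v -> r u + r v <= `|c u - c v| &
  forall u v, graph16 u v -> `|c u - c v| = r u + r v].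
Proof.
have [||b /andP[b_lo b_hi] qb] := @quintic_real_root R (113 / 64) (83 / 47).
- by lra.
- by rewrite /quintic; lra.
pose k := bend b; pose x v := bend_x b v / k v; pose y v := bend_y b v / k v.
have k_gt0 v : 0 < k v by apply: bend_gt0.
pose r (v : nat) := (k v)^-1.
have r_gt0 v : 0 < r v by rewrite invr_gt0.
have rr u v : 0 <= r u + r v by rewrite addr_ge0 ?ltW.
have distE (u v : nat) : (u < 16)%N -> (v < 16)%N ->
    (x u - x v) ^+ 2 + (y u - y v) ^+ 2 =
    (r u + r v) ^+ 2 + (gram b u v - 2) / (k u * k v).
  move=> u16 v16; have ku : k u != 0 by rewrite gt_eqF.
  have kv : k v != 0 by rewrite gt_eqF.
  have hu := gram_self qb u16; have hv := gram_self qb v16.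
  transitivity ((bend_x b u ^+ 2 + bend_y b u ^+ 2) / k u ^+ 2
    + (bend_x b v ^+ 2 + bend_y b v ^+ 2) / k v ^+ 2
    - 2 * (bend_x b u * bend_x b v + bend_y b u * bend_y b v) / (k u * k v)).
    by rewrite /x /y; field; rewrite ku kv.
  by rewrite hu hv -/k /r /gram -/k; field; rewrite ku kv.
exists (fun v => x v +i* y v), (fun v => (r v)%:C); split.
- by move=> v; rewrite ltcR.
- move=> u v uv; rewrite -rmorphD.
  rewrite [_ - _](_ : _ = (x u - x v) +i* (y u - y v)) // normc_sqr //.
  rewrite distE // lerDl divr_ge0 //; last by rewrite mulr_ge0 // ltW.
  by rewrite subr_ge0; apply: gram_ge2.
- move=> u v uv; rewrite -rmorphD; apply/eqP.
  rewrite [_ - _](_ : _ = (x u - x v) +i* (y u - y v)) // normc_sqr //.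
  by rewrite distE // (gram_edge qb uv) subrr mul0r addr0.
Qed.
End ExistenceOfPacking.

(** Ensures that the impossibility below is not vacuous. *)
Lemma graph16_packing : exists c r : 'I_16 -> Cplx, circle_packing graph16 c r.
Proof.
have [c [r [r_gt0 disj tang]]] := packing_exists Rdefinitions.R.
exists c, r; split=> //; split=> [u v uv|u v uv].
  exact/(disjoint_discs _ _ (r_gt0 u) (r_gt0 v))/disj.
exact/tangent_circles/tang.
Qed.

(** The outputs lie in a field over which [r0] keeps degree 5. One further square root puts [lambda]
    of the rim circles 3 and 5, a root of the quintic, into such a field, against
    [quintic_not_root]. *)
Lemma graph16_not_constructible (t : rct 16%N) : ~ rct_constructs_packing graph16 t.
Proof.
move=> [out [run [r_gt0 [disj tang]]]].
have dist u v : u != v -> (out u).2 + (out v).2 <= `|(out u).1 - (out v).1|.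
  by move=> uv; apply/disjoint_discs/disj.
have tdist u v : graph16 u v -> `|(out u).1 - (out v).1| = (out u).2 + (out v).2.
  move=> uv; apply: tangent_dist (tang u v uv); apply: dist.
  by apply: contraTneq uv => ->; rewrite graph16_irr.
have [r0 [r1 [r0R r1R r01 q0 q1]]] := quintic_complex_real_roots Rdefinitions.R.
have [|F [iota [free outF]]] := rct_run_keeps_degree r0R r1R r01 q0 q1 run
  (keeps_degree_rat q0); first by [].
have qb := packing_root r_gt0 dist tdist.
have b2 := lambda_sqr_in_image r_gt0 dist free.1 outF.
have [F1 [iota1 [free1 _ b1]]] :=
  keeps_degree_root r0R r1R r01 q0 q1 free (isT : 0 < 2)%N b2.
have := quintic_not_root q0 free1 b1.
by rewrite -(rmorph_quintic (real_complex Rdefinitions.R)) qb rmorph0 eqxx.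
Qed.


Local Close Scope complex_scope.
Local Close Scope ring_scope.

Theorem theorem12 :
  exists e : rel 'I_16,
    symmetric e /\ irreflexive e /\
    (exists c r : 'I_16 -> Cplx, circle_packing e c r) /\
    forall t : rct 16, ~ rct_constructs_packing e t.
Proof.
exists graph16; split; first exact: graph16_sym.
split; first exact: graph16_irr.
split; [exact: graph16_packing | exact: graph16_not_constructible].
Qed.
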